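(* Let $\mathscr B$ be an object in $\mathbf C$ with the following properties: (1) For each $x\in\mathcal A^\emptyset$ and each $A\in x$, the stalk $(\mathscr B^{\preceq A})^x$ is projective in the category of graded $S$-modules. (2) For each $\mathscr M\in\mathbf C$ and all $A\in\mathcal A$ the following holds: Suppose that for each $B\prec A$ we are given a homomorphism $h^{\preceq B}\colon\mathscr B^{\preceq B}\to\mathscr M^{\preceq B}$ of $\mathcal Z$-modules such that for all $C\prec B\prec A$ the homomorphisms $h^{\preceq B}$ and $h^{\preceq C}$ commute with the restriction homomorphisms $\mathscr B^{\preceq B}\to\mathscr B^{\preceq C}$ and $\mathscr M^{\preceq B}\to\mathscr M^{\preceq C}$ (i.e. $h^{\preceq B}(b)|_{\preceq C}=h^{\preceq C}(b|_{\preceq C})$). Then there is a homomorphism $h^{\preceq A}\colon\mathscr B^{\preceq A}\to\mathscr M^{\preceq A}$ of $\mathcal Z$-modules such that $h^{\preceq A}(b)|_{\preceq B}=h^{\preceq B}(b|_{\preceq B})$ for all $B\prec A$ and $b\in\mathscr B^{\preceq A}$. Then $\mathscr B$ is projective in $\mathbf C$.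
   Context: **Alcoves.** $R$ is a finite irreducible root system in a finite dimensional real vector space $V$, with coroots $\alpha^\vee\in V^*$, pairing $\langle\cdot,\cdot\rangle\colon V\times V^*\to\mathbb R$ and a fixed system of positive roots $R^+$. $X^\vee=\{v\in V^*\mid\langle\alpha,v\rangle\in\mathbb Z\ \forall\alpha\in R\}$. For $\alpha\in R^+$, $n\in\mathbb Z$: $H_{\alpha,n}=\{\mu\in V\mid\langle\mu,\alpha^\vee\rangle=n\}$, $H^{+}_{\alpha,n}$ and $H^-_{\alpha,n}$ are the half-spaces $\langle\mu,\alpha^\vee\rangle>n$ and $<n$, and $s_{\alpha,n}(\mu)=\mu-(\langle\mu,\alpha^\vee\rangle-n)\alpha$. Alcoves are the connected components of $V\setminus\bigcup_{\alpha\in R^+,n\in\mathbb Z}H_{\alpha,n}$; $\mathcal A$ is the set of alcoves. The generic Bruhat order $\preceq$ on $\mathcal A$ is the partial order generated by $A\preceq s_{\alpha,n}(A)$ whenever $A\subset H_{\alpha,n}^-$. For $\lambda\in\mathbb ZR$, $t_\lambda$ is translation by $\lambda$; $\mathcal A^\emptyset:=\mathcal A/\mathbb ZR$ is the set of orbits and $\pi\colon\mathcal A\to\mathcal A^\emptyset$ is the orbit map. For $\alpha\in R^+$ and $A\in\mathcal A$ with $A\subset H_{\alpha,n}^-\cap H_{\alpha,n-1}^+$ put $\alpha\uparrow A:=s_{\alpha,n}(A)$; this is a bijection of $\mathcal A$, and an $\alpha$-string is a set $\{\alpha\uparrow^nA\mid n\in\mathbb Z\}$. **Structure algebra.** $k$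 is a field with $\operatorname{char}k\neq2$ such that $\alpha^\vee\notin k\beta^\vee$ in $X^\vee_k:=X^\vee\otimes_{\mathbb Z}k$ for distinct $\alpha,\beta\in R^+$. $S=S(X_k^\vee)$ is the symmetric algebra, graded with $X_k^\vee$ in degree 2. All modules are graded and homomorphisms preserve the grading. $\mathcal Z$ is the graded $S$-algebra of all tuples $(z_A)\in\prod_{A\in\mathcal A}S$ with $z_A\equiv z_{s_{\alpha,n}(A)}\bmod\alpha^\vee$ for all $A,\alpha\in R^+,n\in\mathbb Z$, and $z_A=z_{t_\lambda(A)}$ for all $\lambda\in\mathbb ZR$. $S^\emptyset:=S[(\beta^\vee)^{-1}\mid\beta\in R^+]$, $S^\alpha:=S[(\beta^\vee)^{-1}\mid\beta\in R^+,\beta\ne\alpha]$, $M^\emptyset:=M\otimes_SS^\emptyset$, $M^\alpha:=M\otimes_SS^\alpha$. $\mathcal Z\text{-mod}^f$ is the full subcategory of $\mathcal Z$-modules $M$ that are torsion free over $S$ and satisfy $M=\bigcap_{\alpha\in R^+}M^\alpha\subset M^\emptyset$. Since $\mathcal Z^\emptyset=\bigoplus_{x\in\mathcal A^\emptyset}S^\emptyset$ (coordinate at $x$), there is a canonical decomposition $M^\emptyset=\bigoplus_{x\in\mathcal A^\emptyset}M^{\emptyset,x}$; $\operatorname{supp}_{\mathcal Z}M:=\{x\mid M^{\emptyset,x}\neq0\}$. The stalk $M^x$ is the image of $M\subset M^\emptyset$ under the projection $M^\emptyset\to M^{\emptyset,x}$. **Sheaves.** $\mathcal A$ is a topological space: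 $\mathcal J$ is open if $A\in\mathcal J$, $B\preceq A$ imply $B\in\mathcal J$. For a presheaf $\mathscr M$, $\mathscr M^{\mathcal J}$ denotes sections over $\mathcal J$, $\mathscr M^{\preceq A}$ sections over $\{B\mid B\preceq A\}$, and $m|_{\mathcal J'}$ restriction. For $\mathcal K$ locally closed, $\mathcal K^-:=\bigcup_{A\in\mathcal K}\{\preceq A\}$, $\mathcal K^-\setminus\mathcal K$ is open, and $\mathscr M_{[\mathcal K]}:=\ker(\mathscr M^{\mathcal K^-}\to\mathscr M^{\mathcal K^-\setminus\mathcal K})$; $\mathscr M_{[A]}:=\mathscr M_{[\{A\}]}$. $\operatorname{supp}_\preceq\mathscr M:=\{A\mid\mathscr M_{[A]}\ne0\}$. $\mathscr M$ is flabby if all restrictions are surjective; it is finitely supported if $\operatorname{supp}_\preceq\mathscr M$ is finite and $\{C\mid\mathscr M^{\preceq C}\neq0\}\subset\bigcup_{i=1}^n\{\succeq A_i\}$ for some $A_1,\dots,A_n\in\mathcal A$. $\mathscr M^\alpha$ is given by $(\mathscr M^\alpha)^{\mathcal J}=\mathscr M^{\mathcal J}\otimes_SS^\alpha$. **The category $\mathbf C$.** $\mathbf C$ is the full subcategory of sheaves of $\mathcal Z$-modules $\mathscr M$ on $\mathcal A$ such that: $\mathscr M^{\mathcal J}\in\mathcal Z\text{-mod}^f$ for all open $\mathcal J$; $\mathscr M$ is flabby and finitely supported; (support condition) $\operatorname{supp}_{\mathcal Z}\mathscr M_{[\mathcal K]}\subset\pi(\mathcal K)$ for each locally closed $\mathcal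 K$; (local extension condition) for each $\alpha\in R^+$, $\mathscr M^\alpha$ is a finite direct sum of sheaves each of which has $\preceq$-support inside a single $\alpha$-string. $\mathbf C$ carries the exact structure whose short exact sequences are those sequences in $\mathbf C$ that are exact as sequences of sheaves of $\mathcal Z$-modules; an object is projective if morphisms from it lift along all epimorphisms of this exact structure (morphisms $\mathscr M\to\mathscr N$ occurring in a short exact sequence $0\to\mathscr L\to\mathscr M\to\mathscr N\to0$ in $\mathbf C$). *)

(* Defs.v *)
From HB Require Import structures.
(* The notations of mpoly clash with those of mathcomp-analysis. *)
From mathcomp Require Import -(notations) mpoly.
From mathcomp Require Import all_boot all_order all_algebra generic_quotient.
From mathcomp Require Import ring.
From mathcomp Require Import all_classical all_reals topology.

Set Implicit Arguments.
Unset Strict Implicit.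
Unset Printing Implicit Defensive.

Import Order.TTheory GRing.Theory Num.Theory numFieldTopology.Exports.
Local Open Scope classical_set_scope.
Local Open Scope quotient_scope.
Local Open Scope ring_scope.

(** * Graded rings and graded modules *)

(* Only the multiplicative part of a gradation is recorded for rings: this
   record is instantiated at S and at the structure algebra only, whose
   gradations are explicit. *)
Record gring := GRingType {
  gring_car :> comPzRingType;
  rdeg : int -> set gring_car;
  rdeg1 : rdeg 0 1;
  rdegM : forall d e a b, rdeg d a -> rdeg e b -> rdeg (d + e) (a * b) }.

Record is_grading (G : gring) (M : lmodType G) (gr : int -> set M) : Prop := {
  grading0 : forall d, gr d 0;
  gradingB : forall d x y, gr d x -> gr d y -> gr d (x - y);
  gradingZ : forall d e (a : G) x,
    rdeg d a -> gr e x -> gr (d + e) (a *: x);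
  grading_span : forall x, exists (s : seq int) (c : int -> M),
    [/\ uniq s, forall i, i \in s -> gr i (c i) & x = \sum_(i <- s) c i];
  grading_free : forall (s : seq int) (c : int -> M), uniq s ->
    (forall i, i \in s -> gr i (c i)) -> \sum_(i <- s) c i = 0 ->
    forall i, i \in s -> c i = 0 }.

Record gmod (G : gring) := GMod {
  gmod_car :> lmodType G;
  gdeg : int -> set gmod_car;
  gdegP : is_grading gdeg }.

Record ghom (G : gring) (M N : gmod G) := GHom {
  ghom_fun :> {linear M -> N};
  ghom_deg : forall d m, gdeg d m -> gdeg d (ghom_fun m) }.

Definition gprojective (G : gring) (P : gmod G) : Prop :=
  forall (M N : gmod G) (f : ghom M N) (g : ghom P N),
    (forall y, exists x, f x = y) ->
    exists h : ghom P M, forall p, f (h p) = g p.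

(** ** Submodules *)

Record submod (A : pzRingType) (M : lmodType A) := SubMod {
  submod_set :> set M;
  submod0 : submod_set 0;
  submodL : forall (a : A) x y,
    submod_set x -> submod_set y -> submod_set (a *: x + y) }.

Section SubmodType.
Variables (A : pzRingType) (M : lmodType A) (N : submod M).

Definition submod_mem : {pred M} := fun x => `[< submod_set N x >].

Lemma submod_memP : submod_closed submod_mem.
Proof.
split; first exact/asboolP/submod0.
by move=> a x y /asboolP xN /asboolP yN; apply/asboolP/submodL.
Qed.

HB.instance Definition _ := GRing.isSubmodClosed.Build A M submod_mem submod_memP.

Record subm := SubM { subm_val : M; subm_valP : subm_val \in submod_mem }.

HB.instance Definition _ := [isSub for subm_val].
HB.instance Definition _ := [Choice of subm by <:].
HB.instance Definition _ := [SubChoice_isSubLmodule of subm by <:].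

Lemma subm_val_inj : injective subm_val.
Proof. exact: val_inj. Qed.

Fact subm_val_is_linear : linear subm_val.
Proof. exact: (linearP (val : subm -> M)). Qed.
HB.instance Definition _ :=
  GRing.isLinear.Build A subm M *:%R subm_val subm_val_is_linear.

End SubmodType.

(** ** Restriction of scalars *)

Definition rscal (A B : pzRingType) (phi : {rmorphism A -> B})
  (M : lmodType B) : Type := M.

Section RestrictScalars.
Variables (A B : pzRingType) (phi : {rmorphism A -> B}) (M : lmodType B).

HB.instance Definition _ := GRing.Zmodule.on (rscal phi M).

Definition rscale (a : A) (x : rscal phi M) : rscal phi M := phi a *: (x : M).

Fact rscaleA a b x : rscale a (rscale b x) = rscale (a * b) x.
Proof. by rewrite /rscale scalerA rmorphM. Qed.
Fact rscale1 : left_id 1 rscale.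
Proof. by move=> x; rewrite /rscale rmorph1 scale1r. Qed.
Fact rscaleDr : right_distributive rscale +%R.
Proof. by move=> a x y; rewrite /rscale scalerDr. Qed.
Fact rscaleDl x : {morph rscale^~ x : a b / a + b}.
Proof. by move=> a b; rewrite /rscale rmorphD scalerDl. Qed.

HB.instance Definition _ := GRing.Zmodule_isLmodule.Build A (rscal phi M)
  rscaleA rscale1 rscaleDr rscaleDl.
End RestrictScalars.

Section GRestrictScalars.
Variables (G H : gring) (phi : {rmorphism G -> H}).
Hypothesis phi_deg : forall d a, rdeg d a -> rdeg d (phi a).

Fact grscal_grading (M : gmod H) :
  @is_grading G (rscal phi M) (@gdeg H M).
Proof.
have MP := gdegP M; split; [exact: grading0 MP | exact: gradingB MP | | |].
- by move=> d e a x ad xe; apply: (gradingZ MP) => //; apply: phi_deg.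
- exact: (grading_span MP).
- exact: (grading_free MP).
Qed.

Definition grscal (M : gmod H) : gmod G := GMod (grscal_grading M).
End GRestrictScalars.

(** ** Localization *)

Record mulset (G : gring) := MulSet {
  mset :> set G;
  mset1 : mset 1;
  msetM : forall s t, mset s -> mset t -> mset (s * t);
  mset_homog : forall t, mset t -> exists e, rdeg e t }.

Section Loc.
Variables (G : gring) (T : mulset G).

Definition den := {t : G | `[< mset T t >]}.

Lemma denP (t : den) : mset T (sval t).
Proof. by case: t => t Tt; apply/asboolP. Qed.

Fact den1_subproof : `[< mset T 1 >]. Proof. by apply/asboolP; apply: mset1. Qed.
Definition den1 : den := exist _ 1 den1_subproof.
Fact denM_subproof (s t : den) : `[< mset T (sval s * sval t) >].
Proof. by apply/asboolP; apply: msetM; apply: denP. Qed.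
Definition denM (s t : den) : den := exist _ (sval s * sval t) (denM_subproof s t).

Section Module.
Variable M : lmodType G.

Definition frac_eq (p q : M * den) : bool :=
  `[< exists2 u, mset T u &
      u *: (sval q.2 *: p.1) = u *: (sval p.2 *: q.1) >].

Fact frac_eq_refl : reflexive frac_eq.
Proof. by move=> p; apply/asboolP; exists 1 => //; apply: mset1. Qed.
Fact frac_eq_sym : symmetric frac_eq.
Proof. by move=> p q; apply/asboolP/asboolP => -[u Tu e]; exists u. Qed.
Fact frac_eq_trans : transitive frac_eq.
Proof.
move=> q p r /asboolP[u Tu e] /asboolP[v Tv f]; apply/asboolP.
exists (u * v * sval q.2).
  by apply: msetM; [apply: msetM | apply: denP].
move: e f; case: p => m s; case: q => m' t; case: r => m'' w /=.
move=> e f; rewrite !scalerA.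
have := congr1 ( *:%R (v * sval w)) e; rewrite !scalerA => e1.
have := congr1 ( *:%R (u * sval s)) f; rewrite !scalerA => f1.
have -> : u * v * sval t * sval w = v * sval w * u * sval t by ring.
rewrite e1; have -> : v * sval w * u * sval s = u * sval s * v * sval w by ring.
by rewrite f1; congr (_ *: _); ring.
Qed.

Canonical frac_eq_equiv :=
  EquivRel frac_eq frac_eq_refl frac_eq_sym frac_eq_trans.

(* The localization of M at T, i.e. M tensored with the localized ring. *)
Definition loc := {eq_quot frac_eq_equiv}.
HB.instance Definition _ := EqQuotient.on loc.
HB.instance Definition _ := Choice.on loc.

Definition frac (m : M) (t : den) : loc := \pi_loc (m, t).

Lemma fracP (v : loc) : exists m t, v = frac m t.
Proof. by exists (repr v).1, (repr v).2; rewrite /frac -surjective_pairing reprK. Qed.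

Lemma fracE m s m' t : frac m s = frac m' t <->
  exists2 u, mset T u & u *: (sval t *: m) = u *: (sval s *: m').
Proof.
split; first by move/eqmodP/asboolP.
by move=> h; apply/eqmodP/asboolP.
Qed.

Lemma frac_denM m t s : frac (sval s *: m) (denM s t) = frac m t.
Proof.
apply/fracE; exists 1; first exact: mset1.
by rewrite !scale1r /= !scalerA mulrC.
Qed.

Lemma denMC s t : denM s t = denM t s.
Proof. by apply: val_inj; rewrite /= mulrC. Qed.

Lemma frac_common (v w : loc) : exists m m' t, v = frac m t /\ w = frac m' t.
Proof.
have [m [s ->]] := fracP v; have [m' [t ->]] := fracP w.
exists (sval t *: m), (sval s *: m'), (denM s t); split.
  by rewrite denMC frac_denM.
by rewrite frac_denM.
Qed.

Lemma frac_common3 (v w x : loc) : exists m m' m'' t,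
  [/\ v = frac m t, w = frac m' t & x = frac m'' t].
Proof.
have [m [m' [t [-> ->]]]] := frac_common v w; have [m'' [s ->]] := fracP x.
exists (sval s *: m), (sval s *: m'), (sval t *: m''), (denM s t); split.
- by rewrite frac_denM.
- by rewrite frac_denM.
- by rewrite denMC frac_denM.
Qed.

Definition locD (v w : loc) : loc :=
  frac (sval (repr w).2 *: (repr v).1 + sval (repr v).2 *: (repr w).1)
    (denM (repr v).2 (repr w).2).
Definition locN (v : loc) : loc := frac (- (repr v).1) (repr v).2.
Definition locZ (a : G) (v : loc) : loc := frac (a *: (repr v).1) (repr v).2.

Lemma repr_frac m t : exists2 u, mset T u &
  u *: (sval t *: (repr (frac m t)).1) = u *: (sval (repr (frac m t)).2 *: m).
Proof. by apply/fracE; rewrite /frac -surjective_pairing reprK. Qed.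

Lemma locDE m m' t : locD (frac m t) (frac m' t) = frac (m + m') t.
Proof.
have [u Tu] := repr_frac m t; have [v Tv] := repr_frac m' t.
rewrite /locD; case: (repr _) => [n' s']; case: (repr _) => [n s] /= e' e.
apply/fracE; exists (u * v); first exact: msetM.
rewrite /= !scalerDr; congr (_ + _); rewrite !scalerA.
- have := congr1 ( *:%R (v * sval s')) e; rewrite !scalerA => e1.
  have -> : u * v * sval t * sval s' = v * sval s' * u * sval t by ring.
  by rewrite e1; congr (_ *: _); ring.
- have := congr1 ( *:%R (u * sval s)) e'; rewrite !scalerA => e1.
  have -> : u * v * sval t * sval s = u * sval s * v * sval t by ring.
  by rewrite e1; congr (_ *: _); ring.
Qed.

Lemma locNE m t : locN (frac m t) = frac (- m) t.
Proof.
have [u Tu e] := repr_frac m t; apply/fracE; exists u => //.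
by rewrite !scalerN e.
Qed.

Lemma locZE a m t : locZ a (frac m t) = frac (a *: m) t.
Proof.
have [u Tu] := repr_frac m t; rewrite /locZ; case: (repr _) => [n s] /= e.
apply/fracE; exists u => //.
have E (x : G) (z : M) : u *: (x *: (a *: z)) = a *: (u *: (x *: z)).
  by rewrite !scalerA; congr (_ *: _); ring.
by rewrite !E e.
Qed.

Lemma frac0 t : frac 0 t = frac 0 den1.
Proof. by apply/fracE; exists 1; [apply: mset1 | rewrite !scaler0]. Qed.

Fact locDA : associative locD.
Proof.
move=> v w x; have [m [m' [m'' [t [-> -> ->]]]]] := frac_common3 v w x.
by rewrite !locDE addrA.
Qed.
Fact locDC : commutative locD.
Proof.
move=> v w; have [m [m' [t [-> ->]]]] := frac_common v w.
by rewrite !locDE addrC.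
Qed.
Fact loc0D : left_id (frac 0 den1) locD.
Proof. by move=> v; have [m [t ->]] := fracP v; rewrite -(frac0 t) locDE add0r. Qed.
Fact locND : left_inverse (frac 0 den1) locN locD.
Proof. by move=> v; have [m [t ->]] := fracP v; rewrite locNE locDE addNr frac0. Qed.

HB.instance Definition _ := GRing.isZmodule.Build loc locDA locDC loc0D locND.

Fact locZA a b v : locZ a (locZ b v) = locZ (a * b) v.
Proof. by have [m [t ->]] := fracP v; rewrite !locZE scalerA. Qed.
Fact locZ1 : left_id 1 locZ.
Proof. by move=> v; have [m [t ->]] := fracP v; rewrite locZE scale1r. Qed.
Fact locZDr : right_distributive locZ +%R.
Proof.
move=> a v w; have [m [m' [t [-> ->]]]] := frac_common v w.
by rewrite [_ + _]locDE !locZE [RHS]locDE scalerDr.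
Qed.
Fact locZDl v : {morph locZ^~ v : a b / a + b}.
Proof.
by move=> a b; have [m [t ->]] := fracP v; rewrite !locZE [RHS]locDE scalerDl.
Qed.

HB.instance Definition _ := GRing.Zmodule_isLmodule.Build G loc
  locZA locZ1 locZDr locZDl.

Lemma addfrac m m' t : frac m t + frac m' t = frac (m + m') t.
Proof. exact: locDE. Qed.
Lemma oppfrac m t : - frac m t = frac (- m) t.
Proof. exact: locNE. Qed.
Lemma scalefrac a m t : a *: frac m t = frac (a *: m) t.
Proof. exact: locZE. Qed.
Lemma frac0E t : frac 0 t = 0. Proof. exact: frac0. Qed.

Lemma sumfrac (I : Type) (r : seq I) (c : I -> M) t :
  \sum_(i <- r) frac (c i) t = frac (\sum_(i <- r) c i) t.
Proof.
elim: r => [|i r ih]; first by rewrite !big_nil frac0E.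
by rewrite !big_cons ih addfrac.
Qed.

(* The action of the element a / s of the localized ring. *)
Definition locact (a : G) (s : den) (v : loc) : loc :=
  frac (a *: (repr v).1) (denM s (repr v).2).

Lemma locactE a s m t : locact a s (frac m t) = frac (a *: m) (denM s t).
Proof.
have [u Tu] := repr_frac m t; rewrite /locact; case: (repr _) => [n w] /= e.
apply/fracE; exists u => //=.
have E (x y : G) (z : M) : u *: ((sval s * x) *: (a *: z)) = (sval s * a) *: (u *: (x *: z)).
  by rewrite !scalerA; congr (_ *: _); ring.
by rewrite !E // e.
Qed.

Fact locact_is_linear a s : linear (locact a s).
Proof.
move=> b v w; have [m [m' [t [-> ->]]]] := frac_common v w.
rewrite scalefrac addfrac !locactE scalefrac addfrac scalerDr; congr (frac (_ + _) _).
by rewrite !scalerA mulrC.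
Qed.
HB.instance Definition _ a s :=
  GRing.isLinear.Build G loc loc *:%R (locact a s) (locact_is_linear a s).

End Module.

Definition locmap (M N : lmodType G) (f : M -> N) (v : loc M) : loc N :=
  frac (f (repr v).1) (repr v).2.

Lemma locmapE (M N : lmodType G) (f : {linear M -> N}) m t :
  locmap f (frac m t) = frac (f m) t.
Proof.
have [u Tu] := repr_frac m t; rewrite /locmap; case: (repr _) => [n w] /= e.
apply/fracE; exists u => //.
by rewrite -[sval t *: _]linearZ -[sval w *: _]linearZ -[LHS]linearZ -[RHS]linearZ e.
Qed.

Fact locmap_is_linear (M N : lmodType G) (f : {linear M -> N}) :
  linear (locmap f).
Proof.
move=> b v w; have [m [m' [t [-> ->]]]] := frac_common v w.
by rewrite scalefrac addfrac !locmapE scalefrac addfrac linearP.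
Qed.
HB.instance Definition _ (M N : lmodType G) (f : {linear M -> N}) :=
  GRing.isLinear.Build G (loc M) (loc N) *:%R (locmap f) (locmap_is_linear f).

(* deg (m / t) = deg m - deg t *)
Definition locdeg (M : gmod G) (d : int) : set (loc M) :=
  [set v | exists m t e, [/\ v = frac m t, rdeg e (sval t) & gdeg (d + e) m]].

Lemma locdeg_common (M : gmod G) (s : seq int) (c : int -> loc M) :
  (forall i, i \in s -> locdeg i (c i)) ->
  exists t e m, rdeg e (sval t) /\
    forall i, i \in s -> c i = frac (m i) t /\ gdeg (i + e) (m i).
Proof.
elim: s => [|j s ih] h.
  by exists den1, 0, (fun=> 0); split=> //; apply: rdeg1.
have hs i : i \in s -> locdeg i (c i) by move=> si; apply: h; rewrite inE si orbT.
have [t [e [m [te hm]]]] := ih hs.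
have [n [w [f [cj wf nf]]]] := h j (mem_head j s).
exists (denM w t), (f + e), (fun i => if i == j then sval t *: n else sval w *: m i).
split; first exact: rdegM.
move=> i; rewrite inE; case: eqP => [-> _|_ /= si].
  rewrite cj denMC frac_denM; split=> //.
  by rewrite addrA [X in gdeg X]addrC; apply: (gradingZ (gdegP M)).
have [-> mi] := hm i si; rewrite frac_denM; split=> //.
by rewrite addrCA; apply: (gradingZ (gdegP M)).
Qed.

Fact loc_grading (M : gmod G) : is_grading (@locdeg M).
Proof.
have MP := gdegP M; split.
- move=> d; exists 0, den1, 0; split; [by rewrite frac0E | exact: rdeg1 |].
  exact: grading0.
- move=> d x y [m [t [e [-> te me]]]] [m' [t' [e' [-> te' me']]]].
  exists (sval t' *: m - sval t *: m'), (denM t t'), (e + e').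
  split; last 2 first.
  + exact: rdegM.
  + apply: (gradingB MP).
      by rewrite addrA addrC; apply: (gradingZ MP).
    by rewrite addrCA; apply: (gradingZ MP).
  by rewrite -addfrac -oppfrac frac_denM denMC frac_denM.
- move=> d e a x ad [m [t [f [-> tf mf]]]].
  exists (a *: m), t, f; split=> //; first by rewrite scalefrac.
  by rewrite -addrA; apply: (gradingZ MP).
- move=> x; have [m [t ->]] := fracP x.
  have [e te] := mset_homog (denP t).
  have [s [c [us cs ->]]] := grading_span MP m.
  exists [seq i - e | i <- s], (fun j => frac (c (j + e)) t); split.
  + by rewrite map_inj_uniq //; apply: addIr.
  + move=> _ /mapP[i si ->]; exists (c i), t, e; rewrite subrK; split=> //.
    exact: cs.
  + rewrite big_map -sumfrac; apply: eq_bigr => i _; by rewrite subrK.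
- move=> s c us cs c0.
  have [t [e [m [te hm]]]] := locdeg_common cs.
  have : frac (\sum_(i <- s) m i) t = frac 0 t.
    rewrite -sumfrac frac0E -[RHS]c0; apply: eq_big_seq => i si.
    by have [-> _] := hm i si.
  move=> /fracE[u Tu]; rewrite !scaler0 scalerA => h0.
  have [f uf] := mset_homog Tu.
  have utd : rdeg (f + e) (u * sval t) by apply: rdegM.
  have idx (i : int) : f + e + (i + e) - e - (f + e) = i by ring.
  have h1 : \sum_(j <- [seq f + e + (i + e) | i <- s])
              (u * sval t) *: m (j - e - (f + e)) = 0.
    rewrite big_map -[RHS]h0 scaler_sumr; apply: eq_bigr => i _.
    by rewrite idx.
  move=> i si; have [-> mi] := hm i si.
  rewrite -(frac0E M t); apply/fracE; exists u => //; rewrite !scaler0 scalerA.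
  rewrite -[in m i](idx i).
  apply: (grading_free MP _ _ h1 (map_f _ si)).
  + by rewrite map_inj_uniq // => x y /addrI /addIr.
  + move=> _ /mapP[j sj ->]; rewrite idx.
    by have [_ mj] := hm j sj; apply: (gradingZ MP).
Qed.

Definition gloc (M : gmod G) : gmod G := GMod (loc_grading M).

Fact locmap_deg (M N : gmod G) (f : ghom M N) d (v : gloc M) :
  gdeg d v -> gdeg d (locmap f v : gloc N).
Proof.
move=> [m [t [e [-> te me]]]]; exists (f m), t, e; split=> //.
  by rewrite locmapE.
exact: ghom_deg.
Qed.
Definition glocmap (M N : gmod G) (f : ghom M N) : ghom (gloc M) (gloc N) :=
  @GHom G (gloc M) (gloc N) (locmap f) (@locmap_deg M N f).

End Loc.

(** * Root systems *)

Record rootSystem (R : realType) (V : vectType R) := RootSystem {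
  roots : seq V;
  coroot : V -> 'Hom(V, R^o);  (* meaningful on roots only *)
  roots_uniq : uniq roots;
  roots_neq0 : 0 \notin roots;
  roots_span : <<roots>>%VS = fullv;
  coroot2 : forall a, a \in roots -> coroot a a = 2;
  coroot_refl : forall a b, a \in roots -> b \in roots ->
    b - coroot a b *: a \in roots;
  coroot_int : forall a b, a \in roots -> b \in roots ->
    exists m : int, coroot a b = m%:~R }.

Definition irreducible_roots (R : realType) (V : vectType R)
    (Phi : rootSystem V) : Prop :=
  (exists a, a \in roots Phi) /\
  forall P : pred V,
    (exists2 a, a \in roots Phi & P a) ->
    (exists2 a, a \in roots Phi & ~~ P a) ->
    exists a b, [/\ a \in roots Phi /\ P a, b \in roots Phi /\ ~~ P b &
      coroot Phi b a != 0 \/ coroot Phi a b != 0].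

Record posRootSystem (R : realType) (V : vectType R) := PosRootSystem {
  rs :> rootSystem V;
  posroot : {pred V};
  pos_sub : {subset posroot <= roots rs};
  posP : exists f : 'Hom(V, R^o), forall a, a \in roots rs ->
    f a != 0 /\ (a \in posroot) = (0 < f a) }.

Section Alcoves.
Variables (R : realType) (V : vectType R) (Phi : posRootSystem V).

Definition in_coweights : set 'Hom(V, R^o) :=
  [set v | forall a, a \in roots Phi -> exists m : int, v a = m%:~R].

Definition in_root_lattice : set V :=
  [set l | exists c : V -> int, l = \sum_(a <- roots Phi) a *~ c a].

Definition hyperplane (a : V) (n : int) : set V := [set v | coroot Phi a v = n%:~R].
Definition halfspace_pos (a : V) (n : int) : set V := [set v | n%:~R < coroot Phi a v].
Definition halfspace_neg (a : V) (n : int) : set V := [set v | coroot Phi a v < n%:~R].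
Definition arefl (a : V) (n : int) (v : V) : V := v - (coroot Phi a v - n%:~R) *: a.
Definition atrans (l v : V) : V := v + l.

Definition hyperplanes_compl : set V :=
  ~` [set v | exists a n, a \in posroot Phi /\ hyperplane a n v].

(* V carries the topology of R^(dim V), transported along coordinates. *)
Definition is_alcove (A : set V) : Prop :=
  exists2 v, hyperplanes_compl v &
    VectorInternalTheory.v2r @` A =
    connected_component (VectorInternalTheory.v2r @` hyperplanes_compl)
      (VectorInternalTheory.v2r v).

Record alcove := Alcove { alcove_set :> set V; alcoveP : is_alcove alcove_set }.

Definition is_refl (a : V) (n : int) (A B : alcove) : Prop :=
  alcove_set B = arefl a n @` alcove_set A.
Definition is_trans (l : V) (A B : alcove) : Prop :=
  alcove_set B = atrans l @` alcove_set A.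

(* The generic Bruhat order. *)
Inductive ale (A : alcove) : alcove -> Prop :=
| ale_refl : ale A A
| ale_step (B C : alcove) (a : V) (n : int) : ale A B -> a \in posroot Phi ->
    alcove_set B `<=` halfspace_neg a n -> is_refl a n B C -> ale A C.

Definition alt (A B : alcove) : Prop := ale A B /\ A <> B.

Lemma ale_trans A B C : ale A B -> ale B C -> ale A C.
Proof.
move=> AB; elim=> // D E a n _ AD aP DH DE.
exact: ale_step AD aP DH DE.
Qed.

(* The graph of the bijection A |-> "a up-arrow A". *)
Definition aup (a : V) (A B : alcove) : Prop :=
  exists n : int, alcove_set A `<=` halfspace_neg a n `&` halfspace_pos a (n - 1) /\
    is_refl a n A B.

Fixpoint up_iter (a : V) (m : nat) (A B : alcove) : Prop :=
  if m is m'.+1 then exists2 C, aup a A C & up_iter a m' C B else A = B.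

Definition astring (a : V) (A : alcove) : set alcove :=
  [set B | exists m, up_iter a m A B \/ up_iter a m B A].

(** ** Orbits under the root lattice *)

Definition orbit_set (A : alcove) : set alcove :=
  [set B | exists2 l, in_root_lattice l & is_trans l A B].

Record aorbit := Orbit {
  orbit_car :> set alcove;
  orbitP : exists A, orbit_car = orbit_set A }.

Definition orb (A : alcove) : aorbit := Orbit (ex_intro _ A erefl).

Lemma root_latticeD l l' :
  in_root_lattice l -> in_root_lattice l' -> in_root_lattice (l + l').
Proof.
move=> [c ->] [c' ->]; exists (fun a => c a + c' a).
by rewrite -big_split; apply: eq_bigr => a _; rewrite mulrzDr.
Qed.

Lemma root_latticeN l : in_root_lattice l -> in_root_lattice (- l).
Proof.
move=> [c ->]; exists (fun a => - c a).
by rewrite -sumrN; apply: eq_bigr => a _; rewrite mulrNz.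
Qed.

Lemma transD l l' : atrans l \o atrans l' = atrans (l' + l).
Proof. by apply/funext => v; rewrite /atrans /= addrA. Qed.

Lemma trans_sym l A B : is_trans l A B -> is_trans (- l) B A.
Proof.
rewrite /is_trans => ->; rewrite image_comp transD subrr.
apply/seteqP; split=> [v Av|_ [v Av <-]]; first by exists v; rewrite // /atrans addr0.
by rewrite /atrans addr0.
Qed.

Lemma orbit_trans (x : aorbit) l A B :
  in_root_lattice l -> is_trans l A B -> orbit_car x A -> orbit_car x B.
Proof.
move=> ll AB; have [C ->] := orbitP x => -[m lm CA].
exists (m + l); first exact: root_latticeD.
by rewrite /is_trans AB CA image_comp transD.
Qed.

(** ** The topology on alcoves *)

Record aopen := AOpen {
  aopen_set :> set alcove;
  aopenP : forall A B, aopen_set A -> ale B A -> aopen_set B }.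

Fact below_subproof (A : alcove) B C :
  [set B | ale B A] B -> ale C B -> [set B | ale B A] C.
Proof. by move=> /= BA CB; apply: ale_trans CB BA. Qed.
Definition below (A : alcove) : aopen := AOpen (@below_subproof A).

Lemma below_mono A B : ale A B -> below A `<=` below B.
Proof. by move=> AB C /= CA; apply: ale_trans CA AB. Qed.

Fact aopenI_subproof (U W : aopen) A B :
  (U `&` W) A -> ale B A -> (U `&` W) B.
Proof. by move=> [UA WA] BA; split; apply: aopenP BA. Qed.
Definition aopenI (U W : aopen) : aopen := AOpen (@aopenI_subproof U W).

Fact aopenU_subproof (F : set aopen) A B :
  (\bigcup_(U in F) aopen_set U) A -> ale B A ->
  (\bigcup_(U in F) aopen_set U) B.
Proof. by move=> [U FU UA] BA; exists U => //; apply: aopenP BA. Qed.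
Definition aopenU (F : set aopen) : aopen := AOpen (@aopenU_subproof F).

Lemma aopenU_sup (F : set aopen) (U : aopen) : F U -> U `<=` aopenU F.
Proof. by move=> FU A UA; exists U. Qed.

Fact aopen_hull_subproof (K : set alcove) A B :
  (\bigcup_(C in K) below C) A -> ale B A -> (\bigcup_(C in K) below C) B.
Proof. by move=> [C KC CA] BA; exists C => //; apply: ale_trans BA CA. Qed.
(* K^- *)
Definition aopen_hull (K : set alcove) : aopen := AOpen (@aopen_hull_subproof K).

Definition locally_closed (K : set alcove) : Prop :=
  exists U W : aopen, K = U `\` W.

Fact aopen_bd_subproof (K : set alcove) A B :
  [set A | aopen_set (aopen_hull K) A /\ forall B, ale B A -> ~ K B] A -> ale B A ->
  [set A | aopen_set (aopen_hull K) A /\ forall B, ale B A -> ~ K B] B.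
Proof.
move=> [KA h] BA; split; first exact: aopenP BA.
by move=> C CB; apply: h; apply: ale_trans CB BA.
Qed.
(* The interior of K^- \ K; see locally_closed_bd. *)
Definition aopen_bd (K : set alcove) : aopen := AOpen (@aopen_bd_subproof K).

Lemma aopen_bd_sub K : aopen_bd K `<=` aopen_hull K.
Proof. by move=> A []. Qed.

Lemma locally_closed_bd K : locally_closed K ->
  aopen_set (aopen_bd K) = aopen_hull K `\` K.
Proof.
move=> [U [W KE]]; apply/seteqP; split=> A.
  by move=> [KA h]; split=> //; apply: h; apply: ale_refl.
move=> [KA nKA]; split=> // B BA KB; apply: nKA.
have [C KC CA] := KA; move: KC KB; rewrite KE => -[UC _] [_ nWB].
by split; [apply: aopenP CA | move=> WA; apply: nWB; apply: aopenP BA].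
Qed.

(** ** The symmetric algebra and the structure algebra *)

(* The coordinates zcoord are determined on the coweight lattice only. *)
Record coweightBasis (n : nat) := CoweightBasis {
  zbasis : 'I_n -> 'Hom(V, R^o);
  zcoord : 'Hom(V, R^o) -> 'I_n -> int;
  zbasis_in : forall i, in_coweights (zbasis i);
  zbasis_span : forall v, in_coweights v -> v = \sum_i zbasis i *~ zcoord v i;
  zbasis_free : forall c : 'I_n -> int,
    \sum_i zbasis i *~ c i = 0 -> forall i, c i = 0 }.


Section StructureAlgebra.
Variables (k : fieldType) (n : nat) (b : coweightBasis n).

(* The symmetric algebra of the coweight lattice over k is the polynomial
   ring on a Z-basis of that lattice. *)
Local Notation S := (mpoly n k).

(* The image of a coweight in S, in polynomial degree 1. *)
Definition coweight_im (v : 'Hom(V, R^o)) : S :=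
  \sum_(i < n) (zcoord b v i)%:~R * mpolyX k (mnm1 i).

Definition crt (a : V) : S := coweight_im (coroot Phi a).

Definition symdeg (d : int) : set S :=
  [set p | p = 0 \/
    exists2 j : nat, d = (2 * j)%:Z & p \is @ishomog1 n k j (@mdeg n)].

Fact symdeg1 : symdeg 0 1.
Proof. by right; exists 0%N => //; exact: dhomog1. Qed.

Fact symdegM d e p q : symdeg d p -> symdeg e q -> symdeg (d + e) (p * q).
Proof.
move=> [->|[i -> hp]]; first by left; rewrite mul0r.
move=> [->|[j -> hq]]; first by left; rewrite mulr0.
right; exists (i + j)%N; first by rewrite mulnDr PoszD.
exact: dhomogM.
Qed.

Definition gsym : gring := GRingType symdeg1 symdegM.

Lemma crt_deg a : symdeg 2 (crt a).
Proof.
right; exists 1%N => //; apply: rpred_sum => i _.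
rewrite mulrzl; apply: rpredMz.
by apply/dhomogP => m; rewrite msuppX inE => /eqP ->; exact: mdeg1.
Qed.

(** *** The structure algebra *)

Definition in_strz : {pred alcove -> S} := fun z =>
  `[< (forall A B a m, a \in posroot Phi -> is_refl a m A B ->
         exists c, z A - z B = c * crt a) /\
      (forall A B l, in_root_lattice l -> is_trans l A B -> z A = z B) >].

Fact in_strz_subring : subring_closed in_strz.
Proof.
split.
- apply/asboolP; split=> //.
  by move=> A B a m _ _; exists 0; rewrite mul0r subrr.
- move=> y z /asboolP[yr yt] /asboolP[zr zt]; apply/asboolP; split.
    move=> A B a m aP AB; have [c e] := yr A B a m aP AB.
    have [d f] := zr A B a m aP AB; exists (c - d).
    by rewrite mulrBl -e -f -[LHS]/(y A - z A - (y B - z B)); ring.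
  by move=> A B l ll AB; rewrite -[LHS]/(y A - z A) (yt A B l) // (zt A B l).
- move=> y z /asboolP[yr yt] /asboolP[zr zt]; apply/asboolP; split.
    move=> A B a m aP AB; have [c e] := yr A B a m aP AB.
    have [d f] := zr A B a m aP AB; exists (c * z A + y B * d).
    rewrite -[LHS]/(y A * z A - y B * z B).
    have -> : y A * z A - y B * z B = (y A - y B) * z A + y B * (z A - z B) by ring.
    by rewrite e f; ring.
  by move=> A B l ll AB; rewrite -[LHS]/(y A * z A) (yt A B l) // (zt A B l).
Qed.

Record strz := StrZ { strz_fun :> alcove -> S; strzP : strz_fun \in in_strz }.

HB.instance Definition _ := [isSub for strz_fun].
HB.instance Definition _ := [Choice of strz by <:].
HB.instance Definition _ := GRing.SubChoice_isSubComPzRing.Build (alcove -> S)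
  in_strz strz in_strz_subring.

Definition strz_deg (d : int) : set strz := [set z | forall A, symdeg d (z A)].

Fact strz_deg1 : strz_deg 0 1.
Proof. by move=> A; apply: symdeg1. Qed.
Fact strz_degM d e y z : strz_deg d y -> strz_deg e z -> strz_deg (d + e) (y * z).
Proof. by move=> yd ze A; apply: symdegM. Qed.

Definition gstrz : gring := GRingType strz_deg1 strz_degM.

Fact strz_diag_subproof (s : S) : (fun=> s) \in in_strz.
Proof.
by apply/asboolP; split=> // A B a m _ _; exists 0; rewrite mul0r subrr.
Qed.

(* The structure morphism of the S-algebra strz. *)
Definition strz_diag (s : gsym) : gstrz := StrZ (strz_diag_subproof s).

Fact strz_diag_is_zmod : zmod_morphism strz_diag.
Proof. by move=> s t; apply: val_inj. Qed.
HB.instance Definition _ :=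
  GRing.isZmodMorphism.Build gsym gstrz strz_diag strz_diag_is_zmod.
Fact strz_diag_is_monoid : monoid_morphism strz_diag.
Proof. by split=> [|s t]; apply: val_inj. Qed.
HB.instance Definition _ :=
  GRing.isMonoidMorphism.Build gsym gstrz strz_diag strz_diag_is_monoid.

Fact strz_diag_deg d (s : gsym) : rdeg d s -> rdeg d (strz_diag s).
Proof. by move=> sd A. Qed.

(** *** Localization of modules over the structure algebra *)

Section Denominators.
Variable Q : pred V.

Definition crt_prods : set gstrz :=
  [set z | exists2 l : seq V, all [in posroot Phi] l && all Q l &
    z = strz_diag (\prod_(a <- l) crt a)].

Fact crt_prods1 : crt_prods 1.
Proof. by exists [::] => //; rewrite big_nil rmorph1. Qed.
Fact crt_prodsM s t : crt_prods s -> crt_prods t -> crt_prods (s * t).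
Proof.
move=> [l hl ->] [l' hl' ->]; exists (l ++ l').
  by rewrite !all_cat; case/andP: hl => -> ->.
by rewrite big_cat rmorphM.
Qed.
Fact crt_prods_homog t : crt_prods t -> exists e, rdeg e t.
Proof.
move=> [l _ ->]; elim: l => [|a l [e ih]].
  by exists 0; rewrite big_nil rmorph1; apply: rdeg1.
exists (2 + e); rewrite big_cons rmorphM; apply: rdegM => //.
by apply: strz_diag_deg; apply: crt_deg.
Qed.

Definition crt_mulset : mulset gstrz := MulSet crt_prods1 crt_prodsM crt_prods_homog.
End Denominators.

(* Products of positive coroots, resp. of positive coroots other than a. *)
Definition den0 : mulset gstrz := crt_mulset predT.
Definition dena (a : V) : mulset gstrz := crt_mulset (predC1 a).

Section Generic.
Variable M : gmod gstrz.
Local Notation M0 := (loc den0 M).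

Definition to_loc : set M0 := [set frac m (den1 den0) | m in [set: M]].
Definition loc_at (a : V) : set M0 :=
  [set v | exists m (t : den den0), mset (dena a) (sval t) /\ v = frac m t].

Definition torsion_free : Prop :=
  forall (s : gsym) (m : M), s != 0 -> strz_diag s *: m = 0 -> m = 0.

(* M^a and M viewed inside the generic localization. *)
Definition zmodf : Prop :=
  torsion_free /\ to_loc = \bigcap_(a in [set a | a \in posroot Phi]) loc_at a.

End Generic.

(** *** Stalks and supports *)

Definition posroots := [seq a <- roots Phi | a \in posroot Phi].

Definition crt_prod : gsym := \prod_(a <- posroots) crt a.

Fact crt_prod_den : `[< mset den0 (strz_diag crt_prod) >].
Proof.
apply/asboolP; exists posroots => //; rewrite all_predT andbT.
by apply/allP => a; rewrite mem_filter => /andP[].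
Qed.
Definition crt_prod0 : den den0 := exist _ (strz_diag crt_prod) crt_prod_den.

(* crt_prod at the alcoves in the orbit x and 0 elsewhere, so that
   char_fun x / crt_prod is the idempotent of the localized structure algebra
   that projects to the coordinate x. *)
Fact char_fun_subproof (x : aorbit) :
  (fun A => if `[< orbit_car x A >] then crt_prod else 0 : S) \in in_strz.
Proof.
apply/asboolP; split=> [A B a m aP _|A B l ll AB].
  have [c ->] : exists c, crt_prod = c * crt a.
    exists (\prod_(b <- rem a posroots) crt b).
    rewrite /crt_prod (big_rem a) /= 1?mulrC // mem_filter aP.
    exact: pos_sub.
  case: ifP => _; case: ifP => _.
  - by exists 0; rewrite subrr mul0r.
  - by exists c; rewrite subr0.
  - by exists (- c); rewrite sub0r mulNr.
  - by exists 0; rewrite subrr mul0r.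
suff -> : `[< orbit_car x A >] = `[< orbit_car x B >] by [].
apply/asbool_equiv_eq; split; first exact: orbit_trans ll AB.
apply: orbit_trans (trans_sym AB); exact: root_latticeN.
Qed.
Definition char_fun (x : aorbit) : gstrz := StrZ (char_fun_subproof x).

Definition orb_proj (M : lmodType gstrz) (x : aorbit) : loc den0 M -> loc den0 M :=
  locact (char_fun x) crt_prod0.
HB.instance Definition _ M x := GRing.Linear.copy (@orb_proj M x)
  (locact (char_fun x) crt_prod0).

Definition orb_part (M : lmodType gstrz) (x : aorbit) : set (loc den0 M) :=
  range (@orb_proj M x).

Definition zsupp (M : lmodType gstrz) : set aorbit :=
  [set x | exists2 v, orb_part x v & v != 0 :> loc den0 M].

Section Stalk.
Variables (M : gmod gstrz) (x : aorbit).

Definition stalk_set : set (loc den0 M) :=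
  [set orb_proj x v | v in @to_loc M].

Fact stalk_set0 : stalk_set 0.
Proof. by exists 0; [exists 0 => //; apply: frac0E | apply: linear0]. Qed.
Fact stalk_setL (a : gstrz) u v :
  stalk_set u -> stalk_set v -> stalk_set (a *: u + v).
Proof.
move=> [_ [m _ <-] <-] [_ [m' _ <-] <-].
exists (frac (a *: m + m') (den1 den0)); first by exists (a *: m + m').
by rewrite -addfrac -scalefrac linearP.
Qed.
Definition stalk_submod : submod (loc den0 M) := SubMod stalk_set0 stalk_setL.
Definition stalk_car : lmodType gstrz := subm stalk_submod.

Definition stalk_deg (d : int) : set stalk_car :=
  [set w | exists2 m : M, gdeg d m &
    subm_val w = orb_proj x (frac m (den1 den0))].

Lemma stalk_mem (m : M) :
  orb_proj x (frac m (den1 den0)) \in submod_mem stalk_submod.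
Proof. by apply/asboolP; exists (frac m (den1 den0)) => //; exists m. Qed.

Lemma char_fun_deg : exists e, rdeg e (char_fun x) /\ rdeg e (strz_diag crt_prod).
Proof.
have [e he] := mset_homog (denP crt_prod0); exists e; split=> // A /=.
by case: ifP => _; [apply: (he A) | left].
Qed.

Lemma orb_proj_deg d (m : M) : gdeg d m ->
  locdeg d (orb_proj x (frac m (den1 den0)) : loc den0 M).
Proof.
move=> dm; have [e [xe de]] := char_fun_deg.
exists (char_fun x *: m), (denM crt_prod0 (den1 den0)), e.
split; first exact: locactE.
  by rewrite -[e]addr0; apply: rdegM => //; apply: rdeg1.
by rewrite addrC; apply: (gradingZ (gdegP M)).
Qed.

Fact stalk_grading : is_grading stalk_deg.
Proof.
have MP := gdegP M; split.
- move=> d; exists 0; first exact: grading0.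
  by rewrite frac0E !linear0.
- move=> d u v [m dm um] [m' dm' vm']; exists (m - m'); first exact: gradingB.
  by rewrite linearB /= um vm' -addfrac -oppfrac linearB.
- move=> d e a u ad [m em um]; exists (a *: m); first exact: (gradingZ MP).
  by rewrite -scalefrac !linearZ /= um.
- move=> u; have /asboolP[_ [m _ <-] um] := subm_valP u.
  have [s [c [us cs mE]]] := grading_span MP m.
  exists s, (fun i => SubM (stalk_mem (c i))); split=> //.
    by move=> i si; exists (c i) => //; apply: cs.
  apply: subm_val_inj; rewrite linear_sum -um mE -sumfrac linear_sum.
  by apply: eq_bigr.
- move=> s c us cs c0 i si; apply: subm_val_inj; rewrite linear0.
  apply: (grading_free (loc_grading den0 M) (c := fun i => subm_val (c i)) us) si.
    by move=> j sj; have [m dm ->] := cs j sj; apply: orb_proj_deg.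
  by rewrite -(linear_sum (@subm_val _ _ stalk_submod)) c0 linear0.
Qed.

Definition stalkz : gmod gstrz := GMod stalk_grading.
Definition stalk : gmod gsym := grscal strz_diag_deg stalkz.
End Stalk.

(** ** Sheaves of graded modules over the structure algebra *)

Record presheaf := Presheaf {
  sect :> aopen -> gmod gstrz;
  restr : forall U W : aopen, W `<=` U -> ghom (sect U) (sect W);
  res_id : forall (U : aopen) (h : U `<=` U) m, restr h m = m;
  res_comp : forall (U W X : aopen) (h : W `<=` U) (h' : X `<=` W) (h'' : X `<=` U) m,
    restr h' (restr h m) = restr h'' m }.

(* The sheaf condition in the category of graded modules: uniqueness, and
   gluing of compatible families that are homogeneous of the same degree. *)
Definition is_sheaf (F : presheaf) : Prop :=
  forall C : set aopen,
  (forall m : F (aopenU C),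
     (forall U (CU : C U), restr F (aopenU_sup CU) m = 0) -> m = 0) /\
  (forall (d : int) (s : forall U, C U -> F U),
     (forall U (CU : C U), gdeg d (s U CU)) ->
     (forall U W (CU : C U) (CW : C W),
        restr F (@subIsetl _ U W : aopenI U W `<=` U) (s U CU) =
        restr F (@subIsetr _ U W : aopenI U W `<=` W) (s W CW)) ->
     exists2 m : F (aopenU C), gdeg d m &
       forall U (CU : C U), restr F (aopenU_sup CU) m = s U CU).

Record sheaf := Sheaf { sheaf_pre :> presheaf; sheafP : is_sheaf sheaf_pre }.

Record shhom (F F' : presheaf) := ShHom {
  shhom_fun :> forall U : aopen, ghom (F U) (F' U);
  shhom_res : forall (U W : aopen) (h : W `<=` U) (m : F U),
    shhom_fun W (restr F h m) = restr F' h (shhom_fun U m) }.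

Definition flabby (F : presheaf) : Prop :=
  forall (U W : aopen) (h : W `<=` U) (m : F W), exists m', restr F h m' = m.

(** *** Sections supported on a locally closed set *)

Section LocalSections.
Variables (F : presheaf) (K : set alcove).

Definition lsect_set : set (F (aopen_hull K)) :=
  [set m | restr F (@aopen_bd_sub K) m = 0].

Fact lsect_set0 : lsect_set 0.
Proof. exact: linear0. Qed.
Fact lsect_setL (a : gstrz) x y :
  lsect_set x -> lsect_set y -> lsect_set (a *: x + y).
Proof. by rewrite /lsect_set /= linearP => -> ->; rewrite scaler0 addr0. Qed.

Definition lsect : submod (F (aopen_hull K)) := SubMod lsect_set0 lsect_setL.
End LocalSections.

Definition psupp (F : presheaf) : set alcove :=
  [set A | exists2 m : F (aopen_hull [set A]), lsect_set m & m != 0].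

Definition finitely_supported (F : presheaf) : Prop :=
  finite_set (psupp F) /\
  exists2 E : set alcove, finite_set E &
    forall C, (exists m : F (below C), m != 0) -> exists2 A, E A & ale A C.

Definition support_condition (F : presheaf) : Prop :=
  forall K : set alcove, locally_closed K ->
    zsupp (subm (lsect F K)) `<=` orb @` K.

(** *** Localization of presheaves *)

Section LocPresheaf.
Variables (T : mulset gstrz) (F : presheaf).

Fact locps_id (U : aopen) (h : U `<=` U) (v : gloc T (F U)) :
  glocmap T (restr F h) v = v.
Proof.
have [m [t ->]] := fracP v.
by rewrite -[LHS]/(locmap _ _) locmapE res_id.
Qed.
Fact locps_comp (U W X : aopen) (h : W `<=` U) (h' : X `<=` W) (h'' : X `<=` U)
    (v : gloc T (F U)) :
  glocmap T (restr F h') (glocmap T (restr F h) v) = glocmap T (restr F h'') v.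
Proof.
have [m [t ->]] := fracP v.
by rewrite -[LHS]/(locmap _ (locmap _ _)) -[RHS]/(locmap _ _) !locmapE (res_comp _ _ h'').
Qed.

Definition locps : presheaf :=
  @Presheaf (fun U => gloc T (F U)) (fun U W h => glocmap T (restr F h))
    locps_id locps_comp.
End LocPresheaf.

(* F^a is the direct sum of the sheaves N i: the maps p i induce a
   bijection onto the product over every open set. *)
Definition local_extension (F : presheaf) : Prop :=
  forall a, a \in posroot Phi ->
    exists (r : nat) (N : 'I_r -> sheaf)
      (p : forall i, shhom (locps (dena a) F) (N i)),
      (forall (U : aopen) (y : forall i, N i U),
         exists! v : locps (dena a) F U, forall i, p i U v = y i) /\
      (forall i, exists A, psupp (N i) `<=` astring a A).

(** *** The category C *)

Definition inC (F : sheaf) : Prop :=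
  [/\ forall U : aopen, zmodf (F U),
      flabby F, finitely_supported F,
      support_condition F & local_extension F].

(* Exactness of 0 -> F1 -> F2 -> F3 -> 0 as a sequence of sheaves. *)
Definition sh_exact (F1 F2 F3 : sheaf) (f : shhom F1 F2) (g : shhom F2 F3) : Prop :=
  [/\ forall U, injective (f U),
      forall (U : aopen) m, g U (f U m) = 0,
      forall (U : aopen) (m : F2 U), g U m = 0 ->
        forall A, aopen_set U A -> exists (W : aopen) (h : W `<=` U),
          aopen_set W A /\ exists l, f W l = restr F2 h m &
      forall (U : aopen) (m : F3 U) A, aopen_set U A ->
        exists (W : aopen) (h : W `<=` U),
          aopen_set W A /\ exists l, g W l = restr F3 h m].

Definition admissible_epi (F F' : sheaf) (g : shhom F F') : Prop :=
  exists (L : sheaf) (f : shhom L F), inC L /\ sh_exact f g.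

Definition projectiveC (P : sheaf) : Prop :=
  inC P /\
  forall (F F' : sheaf) (g : shhom F F') (h : shhom P F'),
    inC F -> inC F' -> admissible_epi g ->
    exists h' : shhom P F, forall U m, g U (h' U m) = h U m.

End StructureAlgebra.
End Alcoves.

Definition gkm_condition (R : realType) (V : vectType R) (Phi : posRootSystem V)
    (k : fieldType) (n : nat) (b : coweightBasis Phi n) : Prop :=
  forall a a', a \in posroot Phi -> a' \in posroot Phi -> a != a' ->
    forall c : k, crt k b a != c *: crt k b a'.

(* Main.v *)
(* Let g : M -> N be an admissible epimorphism with kernel L and h : B -> N a
   morphism; a lift of h is built on the sections over the sets {<= A}, by
   induction on A. Property (2) extends what is given on all {<= C}, C < A, to
   some map a : B^{<=A} -> M^{<=A}. The defect h - g a takes values in N_[A],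
   on which z in Z acts as its coordinate at A by the support condition, so it
   factors through the stalk of B^{<=A} at the orbit of A. This stalk is
   projective by property (1), and M_[A] -> N_[A] is surjective because L is
   flabby; a lift of the defect corrects a.

   The induction is legitimate since B^{<=A} = 0 unless A lies above one of
   finitely many alcoves, and since the integer obtained by summing, over the
   positive roots, the floors of the values of the coroots at a point of A
   strictly increases along the generic Bruhat order. *)

From HB Require Import structures.
From mathcomp Require Import -(notations) mpoly.
From mathcomp Require Import all_boot all_order all_algebra.
From mathcomp Require Import ring lra zify.
From mathcomp Require Import all_classical all_reals topology normedtype.
Require Import Defs.

Set Implicit Arguments.
Unset Strict Implicit.
Unset Printing Implicit Defensive.

Import Order.TTheory GRing.Theory Num.Theory numFieldNormedType.Exports.
Local Open Scope classical_set_scope.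
Local Open Scope ring_scope.

(** * Coroots *)

Section RootSystems.
Variables (R : realType) (V : vectType R) (Phi : posRootSystem V).
Local Notation "a ^v" := (coroot Phi a) (at level 2, format "a ^v").
Local Notation sref a x := (x - a^v x *: a).

Lemma span_root_eq (f g : 'Hom(V, R^o)) :
  (forall c, c \in roots Phi -> f c = g c) -> f = g.
Proof.
move=> fg; apply/lfunP => x.
have : x \in <<in_tuple (roots Phi)>>%VS by rewrite roots_span memvf.
move=> /coord_span ->; rewrite !linear_sum; apply: eq_bigr => i _.
by rewrite !linearZ /= fg // mem_nth.
Qed.

Lemma homB (f : 'Hom(V, R^o)) x t y : f (x - t *: y) = f x - t * f y :> R.
Proof. by rewrite linearB linearZ. Qed.

Lemma homD (f : 'Hom(V, R^o)) x t y : f (x + t *: y) = f x + t * f y :> R.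
Proof. by rewrite linearD linearZ. Qed.

Lemma srefK a x : a \in roots Phi -> sref a (sref a x) = x.
Proof.
move=> aR; rewrite homB coroot2 // -addrA -opprD -scalerDl.
have -> : a^v x + (a^v x - a^v x * 2) = 0 by ring.
by rewrite scale0r subr0.
Qed.

(* The product of the two reflections is the transvection [x + (g x - f x) *: a];
   its powers would move a root to infinitely many roots unless [f = g]. *)
Lemma coroot_uniq (a : V) (f g : 'Hom(V, R^o)) : a \in roots Phi ->
  f a = 2 -> g a = 2 ->
  (forall c, c \in roots Phi -> c - f c *: a \in roots Phi) ->
  (forall c, c \in roots Phi -> c - g c *: a \in roots Phi) -> f = g.
Proof.
move=> aR fa ga fP gP; apply: span_root_eq => c cR.
have h m : c + (m%:R * (g c - f c)) *: a \in roots Phi.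
  elim: m => [|m ih]; first by rewrite mul0r scale0r addr0.
  have := fP _ (gP _ ih); set y := c + _.
  rewrite (_ : y - _ - _ = c + (m.+1%:R * (g c - f c)) *: a) //.
  have gy : g y = g c + m%:R * (g c - f c) * 2 by rewrite homD ga.
  have fy : f (y - g y *: a) = f c + m%:R * (g c - f c) * 2 - g y * 2.
    by rewrite homB homD fa.
  set s := f _ in fy *; set t := g y in gy fy *.
  rewrite /y -!addrA; congr (_ + _); rewrite -!scaleNr -!scalerDl fy gy.
  by congr (_ *: _); rewrite -natr1; ring.
apply/eqP; apply: contraT => fgc.
have a0 : a != 0 by apply: contraTneq aR => ->; exact: roots_neq0.
pose s := [seq c + (m%:R * (g c - f c)) *: a | m <- iota 0 (size (roots Phi)).+1].
have us : uniq s.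
  rewrite map_inj_uniq ?iota_uniq // => i j /addrI /eqP.
  rewrite -subr_eq0 -scalerBl scaler_eq0 (negPf a0) orbF -mulrBl mulf_eq0.
  by rewrite !subr_eq0 [g c == _]eq_sym (negPf fgc) orbF eqr_nat => /eqP.
have := uniq_leq_size us; rewrite size_map size_iota => /(_ (roots Phi)).
by rewrite ltnn => /(_ _) /= -> // x /mapP[m _ ->].
Qed.

Lemma sref_root a c : a \in roots Phi -> c \in roots Phi -> sref a c \in roots Phi.
Proof. exact: coroot_refl. Qed.

(** By [coroot_uniq] at the root s_a c: the functional [c^v - c^v a *: a^v] takes the value 2 there,
    and its reflection is s_a s_c s_a, which preserves the roots. *)
Lemma coroot_sref a c x : a \in roots Phi -> c \in roots Phi ->
  (sref a c)^v x = c^v (sref a x).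
Proof.
move=> aR cR.
have E y : (c^v - c^v a *: a^v) y = c^v (sref a y).
  rewrite homB !lfunE /= !lfunE /= !lfunE /=.
  by congr (_ - _); apply: mulrC.
suff -> : (sref a c)^v = c^v - c^v a *: a^v by rewrite E.
apply: (@coroot_uniq (sref a c)); rewrite ?sref_root //.
- by rewrite coroot2 // sref_root.
- by rewrite E srefK // coroot2.
- by move=> y yR; apply: coroot_refl => //; apply: sref_root.
- move=> y yR; rewrite E.
  rewrite (_ : _ - _ = sref a (sref c (sref a y))).
    by apply: sref_root => //; apply: sref_root => //; apply: sref_root.
  set y' := sref a y; rewrite -{1}(srefK y aR) -/y' (homB _ y').
  rewrite scalerBl scalerBr scalerA !opprB !addrA [LHS]addrAC [RHS]addrAC.
  by congr (_ + _); rewrite addrAC.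
Qed.

Lemma perm_sref a : a \in roots Phi ->
  perm_eq [seq sref a c | c <- roots Phi] (roots Phi).
Proof.
move=> aR; have us : uniq [seq sref a c | c <- roots Phi].
  rewrite map_inj_in_uniq ?roots_uniq // => x y _ _ e.
  by rewrite -(srefK x aR) e srefK.
apply: uniq_perm => //; first exact: roots_uniq.
have sub : {subset [seq sref a c | c <- roots Phi] <= roots Phi}.
  by move=> _ /mapP[c cR ->]; apply: sref_root.
by have [] := uniq_min_size us sub; rewrite ?size_map.
Qed.

(** The canonical symmetric form invariant under all the reflections; it serves to compare the signs
    of [a^v c] and [c^v a]. *)
Definition rform (x y : V) : R := \sum_(c <- roots Phi) c^v x * c^v y.

Lemma rform_sref a x y : a \in roots Phi ->
  rform (sref a x) (sref a y) = rform x y.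
Proof.
move=> aR; rewrite /rform -[RHS](perm_big _ (perm_sref aR)) big_map.
by apply: eq_big_seq => c cR; rewrite !coroot_sref.
Qed.

Lemma rform_coroot a x : a \in roots Phi ->
  2 * rform x a = a^v x * rform a a.
Proof.
move=> aR; have := rform_sref x a aR.
have E : rform (sref a x) (sref a a) = - rform x a + a^v x * rform a a.
  rewrite /rform -sumrN mulr_sumr -big_split; apply: eq_bigr => c _ /=.
  by rewrite !homB coroot2 //; ring.
by rewrite E; lra.
Qed.

Lemma rformC x y : rform x y = rform y x.
Proof. by apply: eq_bigr => c _; rewrite mulrC. Qed.

Lemma rform_gt0 a : a \in roots Phi -> 0 < rform a a.
Proof.
move=> aR; rewrite /rform (big_rem a) //= ltr_pwDl //.
  by rewrite coroot2 //; lra.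
by rewrite sumr_ge0 // => c _; rewrite -expr2 sqr_ge0.
Qed.

(** Both values are positive multiples of [rform a c]. *)
Lemma coroot_sign a c : a \in roots Phi -> c \in roots Phi ->
  (0 < a^v c) = (0 < c^v a).
Proof.
move=> aR cR; have h1 := rform_coroot c aR; have h2 := rform_coroot a cR.
move: h1; rewrite rformC h2 => e.
by rewrite -(pmulr_lgt0 _ (rform_gt0 aR)) -e pmulr_lgt0 // rform_gt0.
Qed.

End RootSystems.

(** * Alcoves *)

Section AlcoveFloors.
Import VectorInternalTheory.
Variables (R : realType) (V : vectType R) (Phi : posRootSystem V).
Local Notation "a ^v" := (coroot Phi a) (at level 2, format "a ^v").
Local Notation compl := (hyperplanes_compl Phi).
Implicit Types A B : alcove Phi.

Lemma hom_r2v_continuous (f : 'Hom(V, R^o)) :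
  continuous (fun u : 'rV[R]_(dim V) => f (r2v u) : R).
Proof.
have -> : (fun u : 'rV[R]_(dim V) => f (r2v u) : R) =
    (fun u => \sum_i u 0 i * f (r2v (delta_mx 0 i))).
  apply/funext => u; rewrite {1}(row_sum_delta u) !linear_sum.
  by apply: eq_bigr => i _; rewrite !linearZ.
apply: continuous_big; first exact: add_continuous.
move=> i _ u; apply: continuousM; last exact: cst_continuous.
exact: coord_continuous.
Qed.

Lemma segment_continuous n (x y : 'rV[R]_n) : continuous (fun t : R => x + t *: y).
Proof.
move=> t; apply: cvgD; first exact: cvg_cst.
exact: cvgZr_tmp.
Qed.

Lemma alcove_component A v : alcove_set A v ->
  v2r @` A = connected_component (v2r @` compl) (v2r v).
Proof.
have [v0 _ e] := alcoveP A; move=> Av; rewrite e.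
by apply: same_connected_component; rewrite -e; exists v.
Qed.

Lemma alcove_compl A : alcove_set A `<=` compl.
Proof.
move=> v Av; have : (v2r @` A) (v2r v) by exists v.
rewrite (alcove_component Av) => /connected_component_sub[w wc /v2r_inj].
by move=> <-.
Qed.

Lemma alcove_meet A : exists v, alcove_set A v.
Proof.
have [v0 v0c e] := alcoveP A.
have : (v2r @` A) (v2r v0).
  by rewrite e; apply: connected_component_refl; exists v0.
by case=> v Av _; exists v.
Qed.

Lemma alcove_eqP A B : alcove_set A = alcove_set B -> A = B.
Proof.
case: A B => A pA [B pB] /= e; move: pA pB; rewrite e => pA pB.
by rewrite (Prop_irrelevance pA pB).
Qed.

Lemma alcove_common A B v : alcove_set A v -> alcove_set B v -> A = B.
Proof.
move=> Av Bv; apply: alcove_eqP; apply/funext => x.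
rewrite -(image_inj (@v2r_inj R V)) -[RHS](image_inj (@v2r_inj R V)).
by rewrite (alcove_component Av) (alcove_component Bv).
Qed.

Lemma alcove_at v : compl v -> exists A, alcove_set A v.
Proof.
move=> vc; set C := connected_component (v2r @` compl) (v2r v).
have E : v2r @` (r2v @` C) = C.
  rewrite image_comp (_ : v2r \o r2v = id) ?image_id //.
  by apply/funext => u /=; rewrite r2vK.
have hA : is_alcove Phi (r2v @` C) by exists v.
exists (Alcove hA); exists (v2r v); last by rewrite v2rK.
by apply: connected_component_refl; exists v.
Qed.

Lemma complP v a m : compl v -> a \in posroot Phi -> a^v v != m%:~R.
Proof.
by move=> vc aP; apply/eqP => e; apply: vc; exists a, m; split.
Qed.

(* Otherwise the image of the connected set A under [a^v] would contain an integer. *)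
Lemma alcove_floor A v w a : alcove_set A v -> alcove_set A w -> a \in posroot Phi ->
  Num.floor (a^v v) = Num.floor (a^v w).
Proof.
wlog vw : v w / a^v v <= a^v w.
  move=> H Av Aw aP; have [/H->//|/ltW /H h] := leP (a^v v) (a^v w).
  by rewrite h.
move=> Av Aw aP; apply/eqP; apply: contraT => nvw.
have lt : Num.floor (a^v v) < Num.floor (a^v w).
  by rewrite lt_neqAle nvw /=; apply: le_floor.
pose f u := a^v (r2v u) : R.
have : connected (f @` (v2r @` A)).
  apply: connected_continuous_connected.
    by rewrite (alcove_component Av); apply: component_connected.
  by apply: continuous_subspaceT; apply: hom_r2v_continuous.
move=> /connected_intervalP ic.
have fA x : alcove_set A x -> (f @` (v2r @` A)) (a^v x).
  by move=> Ax; exists (v2r x); [exists x | rewrite /f v2rK].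
have : (f @` (v2r @` A)) (Num.floor (a^v w))%:~R.
  apply: (ic _ _ (fA _ Av) (fA _ Aw)).
  rewrite floor_le // andbT; apply: ltW.
  have /andP[_ /lt_le_trans] := floor_itv (a^v v); apply.
  by rewrite ler_int lezD1.
move=> [_ [x Ax <-]]; rewrite /f v2rK => e.
by have := complP (Num.floor (a^v w)) (alcove_compl Ax) aP; rewrite e eqxx.
Qed.

Lemma floor_between (x y z : R) (m : int) : Num.floor x = Num.floor y ->
  x != m%:~R -> y != m%:~R -> z \in `[x, y] -> z != m%:~R.
Proof.
move=> e xm ym; rewrite in_itv /= => /andP[xz zy]; apply/eqP => zm; subst z.
have : Num.floor y = m.
  apply/eqP; rewrite eq_le -{1}e -(@ler_int R) -[X in _ && X](@ler_int R).
  rewrite (le_trans (floor_le _) xz) /=.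
  by rewrite ler_int floor_ge_int.
move=> fy; move: e; rewrite fy => fx; have := floor_le x.
by rewrite fx => mx; move: xm; rewrite eq_le mx xz.
Qed.

(* The segment from v to w avoids all the hyperplanes. *)
Lemma floor_alcove A v w : alcove_set A v -> compl w ->
  (forall a, a \in posroot Phi -> Num.floor (a^v v) = Num.floor (a^v w)) ->
  alcove_set A w.
Proof.
move=> Av wc h; pose g (t : R) := v2r v + t *: (v2r w - v2r v).
have : (v2r @` A) (v2r w).
  rewrite (alcove_component Av).
  apply: (@connected_component_max _ _ (g @` `[0, 1])).
  - by exists 0; rewrite /= ?in_itv /= ?lexx ?ler01 // /g scale0r addr0.
  - move=> _ [t /= t01 <-]; exists (v + t *: (w - v)); last first.
      by rewrite linearD linearZ linearB.
    move=> [a [m [aP]]]; rewrite /hyperplane /= linearD linearZ linearB /=.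
    move: t01; rewrite in_itv /= => /andP[t0 t1].
    have av := complP m (alcove_compl Av) aP; have aw := complP m wc aP.
    have e := h a aP.
    rewrite -[t *: _]/(t * _); set x := a^v v in e av *; set y := a^v w in e aw *.
    apply/eqP; have [xy|/ltW xy] := leP x y.
      apply: (floor_between e) => //; rewrite in_itv /=.
      by apply/andP; split; nra.
    apply: (floor_between (esym e)) => //; rewrite in_itv /=.
    by apply/andP; split; nra.
  - apply: connected_continuous_connected; first exact: segment_connected.
    by apply: continuous_subspaceT; apply: segment_continuous.
  - by exists 1; rewrite /= ?in_itv /= ?lexx ?ler01 // /g scale1r addrC subrK.
by case=> x Ax /v2r_inj <-.
Qed.

End AlcoveFloors.

(** * The generic Bruhat order *)

Section GenericLength.
Variables (R : realType) (V : vectType R) (Phi : posRootSystem V).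
Local Notation "a ^v" := (coroot Phi a) (at level 2, format "a ^v").
Local Notation sref a x := (x - a^v x *: a).
Implicit Types A B C : alcove Phi.

Lemma mem_posroots a : (a \in posroots Phi) = (a \in posroot Phi).
Proof.
by rewrite mem_filter andb_idr // => aP; apply: pos_sub.
Qed.

Lemma sref_diag a : a \in roots Phi -> sref a a = - a.
Proof.
by move=> aR; rewrite coroot2 // scaler_nat mulr2n opprD addrA subrr add0r.
Qed.

(** For a functional f defining positivity, f(s_a c) = f c - [a^v c] f a <= 0 with f a, f c > 0
    forces [a^v c] > 0; [coroot_sign] exchanges the two roots. *)
Lemma sref_neg a c : a \in posroot Phi -> c \in posroot Phi ->
  sref a c \notin posroot Phi -> 0 < c^v a.
Proof.
move=> aP cP; have [f fP] := posP Phi.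
have aR := pos_sub aP; have cR := pos_sub cP.
have [_ fa] := fP a aR; have [_ fc] := fP c cR.
have [_ ->] := fP _ (sref_root aR cR); rewrite homB -leNgt => fs.
move: aP cP; rewrite fa fc -coroot_sign // => fa0 fc0.
rewrite -(pmulr_lgt0 _ fa0); apply: lt_le_trans fc0 _.
by rewrite -subr_le0.
Qed.

Lemma posroot_opp a : a \in posroot Phi -> - a \notin posroot Phi.
Proof.
move=> aP; have [f fP] := posP Phi; have aR := pos_sub aP.
have naR : - a \in roots Phi by rewrite -sref_diag // sref_root.
have [_ fa] := fP a aR; have [_ ->] := fP _ naR.
by rewrite linearN oppr_gt0 -leNgt ltW // -fa.
Qed.

(** An involution of the positive roots, used to reindex sums over them; it fixes the roots that s_a
    makes negative. *)
Definition psref (a c : V) : V := if sref a c \in posroot Phi then sref a c else c.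

Lemma psrefK a c : a \in posroot Phi -> c \in posroot Phi ->
  psref a (psref a c) = c.
Proof.
move=> aP cP; have aR := pos_sub aP; rewrite /psref.
case sc: (sref a c \in posroot Phi); last by rewrite sc.
by rewrite srefK // cP.
Qed.

Lemma perm_psref a : a \in posroot Phi ->
  perm_eq [seq psref a c | c <- posroots Phi] (posroots Phi).
Proof.
move=> aP; have up : uniq (posroots Phi) by rewrite filter_uniq ?roots_uniq.
have us : uniq [seq psref a c | c <- posroots Phi].
  rewrite map_inj_in_uniq // => x y; rewrite !mem_posroots => xP yP e.
  by rewrite -(psrefK aP xP) e psrefK.
apply: uniq_perm => //.
have sub : {subset [seq psref a c | c <- posroots Phi] <= posroots Phi}.
  move=> x /mapP[c]; rewrite !mem_posroots => cP ->.
  by rewrite /psref; case: ifP.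
by have [] := uniq_min_size us sub; rewrite ?size_map.
Qed.

(** For v off the hyperplanes, the signed number of hyperplanes separating v from the alcove on
    which every positive coroot takes values between 0 and 1. *)
Definition vlen (v : V) : int := \sum_(c <- posroots Phi) Num.floor (c^v v).

Lemma coroot_arefl a m c v : a \in roots Phi -> c \in roots Phi ->
  c^v (arefl Phi a m v) = (sref a c)^v v + m%:~R * c^v a.
Proof.
by move=> aR cR; rewrite coroot_sref // /arefl !homB; ring.
Qed.

(* Positive roots c with [s_a c] positive cancel in pairs; for the others
   [c^v a > 0], so that the reflection does not decrease [c^v]. *)
Lemma vlen_arefl a m v : a \in posroot Phi -> a^v v < m%:~R ->
  vlen v < vlen (arefl Phi a m v).
Proof.
move=> aP vm; have aR := pos_sub aP.
pose q c : int := Num.floor (c^v a).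
have qE c : c \in roots Phi -> c^v a = (q c)%:~R.
  by move=> cR; have [j e] := coroot_int cR aR; rewrite /q e intrKfloor.
pose h c : int := if sref a c \in posroot Phi then m * q c else 0.
pose k c : int := if sref a c \in posroot Phi then 0
  else Num.floor (c^v (arefl Phi a m v)) - Num.floor (c^v v).
have qs c : c \in roots Phi -> q (sref a c) = - q c.
  move=> cR; apply/eqP; rewrite -(@eqr_int R) -qE ?sref_root // coroot_sref //.
  by rewrite sref_diag // linearN /= qE // mulrNz.
(* Reindexing by [psref] changes the sign of the sum, because [q (s_a c) = - q c]. *)
have h0 : \sum_(c <- posroots Phi) h c = 0.
  have : \sum_(c <- posroots Phi) h c = - \sum_(c <- posroots Phi) h c.
    rewrite -{1}(perm_big _ (perm_psref aP)) big_map -sumrN.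
    apply: eq_big_seq => c; rewrite mem_posroots => cP; have cR := pos_sub cP.
    rewrite /h /psref; case sc: (sref a c \in posroot Phi); last by rewrite sc oppr0.
    by rewrite srefK // cP qs // mulrN.
  by move/eqP; rewrite -addr_eq0 -mulr2n mulrn_eq0 /= => /eqP.
(* Reindexing the second sum by [psref] compares c after the reflection with s_a c before it, if the
   latter is positive; the two floors then differ by [m * q c]. *)
have E : vlen (arefl Phi a m v) - vlen v =
    \sum_(c <- posroots Phi) k c.
  rewrite /vlen -[X in _ - X](perm_big _ (perm_psref aP)) big_map -sumrB.
  rewrite -[RHS]add0r -[X in _ = X + _]h0 -big_split /=.
  apply: eq_big_seq => c; rewrite mem_posroots => cP; have cR := pos_sub cP.
  rewrite /h /k /psref; case: ifP => [sc|sc]; last by rewrite add0r.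
  rewrite coroot_arefl // qE // -intrM floorDrz ?intr_int // intrKfloor.
  by rewrite addr0 addrAC subrr add0r.
have k_ge0 c : c \in posroot Phi -> 0 <= k c.
  move=> cP; rewrite /k; case: ifPn => // sc; rewrite subr_ge0.
  have ca := sref_neg aP cP sc.
  apply: le_floor; rewrite /arefl homB lerDl.
  by nra.
(* The term of a itself is positive: the value of [a^v] passes from below m to above m. *)
rewrite -subr_gt0 E (big_rem a) ?mem_posroots //= ltr_pwDl //.
  rewrite /k sref_diag // (negPf (posroot_opp aP)) subr_gt0.
  apply: (@lt_le_trans _ _ m).
    by rewrite -(@ltr_int R); apply: le_lt_trans vm; apply: floor_le.
  by rewrite floor_ge_int /arefl homB coroot2 //; lra.
rewrite big_seq; apply: sumr_ge0 => c /mem_rem.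
by rewrite mem_posroots; apply: k_ge0.
Qed.

Definition alen A : int := vlen (sval (cid (alcove_meet A))).

Lemma alenE A v : alcove_set A v -> alen A = vlen v.
Proof.
move=> Av; rewrite /alen; case: cid => w /= Aw; apply: eq_big_seq => c.
by rewrite mem_posroots => cP; rewrite (alcove_floor Aw Av cP).
Qed.

Lemma ale_alen A B : ale A B -> A = B \/ alen A < alen B.
Proof.
elim=> [|B' C a m _ ih aP BH BC]; first by left.
right; have [v Bv] := alcove_meet B'.
have Cw : alcove_set C (arefl Phi a m v) by rewrite BC; exists v.
have lt : alen B' < alen C.
  by rewrite (alenE Bv) (alenE Cw) vlen_arefl //; apply: BH.
by case: ih => [->//|/lt_trans]; apply.
Qed.

Lemma alt_alen A B : alt A B -> alen A < alen B.
Proof. by case=> /ale_alen[]. Qed.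

Lemma ale_anti A B : ale A B -> ale B A -> A = B.
Proof.
move=> /ale_alen[//|lt] /ale_alen[//|/(lt_trans lt)].
by rewrite ltxx.
Qed.

End GenericLength.

(** * Orbits of alcoves under the root lattice *)

Section FiniteOrbits.
Variables (R : realType) (V : vectType R) (Phi : posRootSystem V).
Local Notation "a ^v" := (coroot Phi a) (at level 2, format "a ^v").
Local Notation compl := (hyperplanes_compl Phi).
Implicit Types A B C : alcove Phi.

Lemma coroot_lattice c l : c \in roots Phi -> in_root_lattice Phi l ->
  exists m : int, c^v l = m%:~R.
Proof.
move=> cR [x ->]; rewrite linear_sum /= big_seq.
elim/big_ind: _ => [|_ _ [m ->] [m' ->]|a aR].
- by exists 0.
- by exists (m + m'); rewrite intrD.
- have [m e] := coroot_int cR aR; exists (m * x a).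
  by rewrite raddfMz /= e intrM mulrzr.
Qed.

Lemma compl_trans l v : in_root_lattice Phi l -> compl v -> compl (v + l).
Proof.
move=> ll vc [a [m [aP]]]; rewrite /hyperplane /= linearD /=.
have [j ->] := coroot_lattice (pos_sub aP) ll => e.
apply: vc; exists a, (m - j); split=> //.
by rewrite /hyperplane /= intrB -e addrK.
Qed.

Lemma floor_trans l v w c : c \in roots Phi -> in_root_lattice Phi l ->
  Num.floor (c^v v) = Num.floor (c^v w) ->
  Num.floor (c^v (v + l)) = Num.floor (c^v (w + l)).
Proof.
move=> cR ll e; have [m lm] := coroot_lattice cR ll.
by rewrite !linearD /= lm !floorDrz ?intr_int // e.
Qed.

(** An alcove is determined by the floors of its points, and a lattice translation shifts these by
    integers that depend on the translation only; hence one point decides. *)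
Lemma alcove_trans l A B v : in_root_lattice Phi l ->
  alcove_set A v -> alcove_set B (v + l) -> is_trans l A B.
Proof.
have sub l' (C D : alcove Phi) x : in_root_lattice Phi l' -> alcove_set C x ->
    alcove_set D (x + l') -> forall y, alcove_set C y -> alcove_set D (y + l').
  move=> ll Cx Dx y Cy; apply: (floor_alcove Dx).
    by apply: compl_trans => //; apply: alcove_compl Cy.
  move=> a aP; apply: floor_trans (pos_sub aP) ll _.
  exact: (alcove_floor Cx Cy aP).
move=> ll Av Bv; apply/seteqP; split=> [x Bx|_ [y Ay <-]]; last first.
  exact: (sub _ _ _ _ ll Av Bv _ Ay).
exists (x - l); last by rewrite /atrans subrK.
by apply: (sub _ B A (v + l)) => //; [apply: root_latticeN | rewrite addrK].
Qed.

Lemma root_combination v : exists x : V -> R, v = \sum_(a <- roots Phi) x a *: a.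
Proof.
pose X := in_tuple (roots Phi).
have /coord_span vE : v \in <<X>>%VS by rewrite roots_span memvf.
exists (fun a => oapp (fun i => coord X i v) 0 (insub (index a (roots Phi)))).
rewrite {1}vE (big_nth 0) big_mkord; apply: eq_bigr => i _.
by rewrite index_uniq ?roots_uniq // valK.
Qed.

(** Writing v as a combination of roots and taking the integral parts of the coefficients for l
    leaves coefficients in [0, 1), whence the bound K. *)
Lemma lattice_reduction : exists K : R, forall v, exists2 l,
  in_root_lattice Phi l & forall c, c \in roots Phi -> `|c^v (v - l)| <= K.
Proof.
exists (\sum_(c <- roots Phi) \sum_(a <- roots Phi) `|c^v a|) => v.
have [x vE] := root_combination v.
exists (\sum_(a <- roots Phi) a *~ Num.floor (x a)).
  by exists (fun a => Num.floor (x a)).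
move=> c cR; rewrite {1}vE -sumrB linear_sum /=.
apply: le_trans (ler_norm_sum _ _ _) _.
rewrite [leRHS](big_rem c) //=; apply: ler_wpDr.
  by apply: sumr_ge0 => d _; apply: sumr_ge0 => a _; apply: normr_ge0.
apply: ler_sum => a _; rewrite -scaler_int -scalerBl linearZ /=.
rewrite normrM -[leRHS]mul1r ler_wpM2r //.
have /andP[h1 h2] := floor_itv (x a); rewrite ger0_norm ?subr_ge0 //.
by rewrite intrD in h2; rewrite lerBlDr addrC ltW.
Qed.

(** Each orbit meets the region where all coroots are bounded by K; the floors take finitely many
    values there and determine the alcove. *)
Lemma finite_orbits (A0 : alcove Phi) : exists (T : finType) (c : T -> alcove Phi),
  forall A, exists t, orbit_car (orb (c t)) A.
Proof.
have [K KP] := lattice_reduction.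
pose N := (Num.truncn K).+1.
pose r (i : 'I_(size (posroots Phi))) := (posroots Phi)`_i.
have rP i : r i \in posroot Phi by rewrite -mem_posroots mem_nth.
pose bd v := forall a, a \in posroot Phi -> `|a^v v| <= K.
(* The shift by N makes the floors natural numbers at most 2N, so that [inord] loses no information
   on the bounded region. *)
pose phi v : {ffun 'I_(size (posroots Phi)) -> 'I_(N.*2).+1} :=
  [ffun i => inord `|Num.floor ((r i)^v v) + N%:Z|].
have phiP v w : bd v -> bd w -> phi v = phi w ->
    forall a, a \in posroot Phi -> Num.floor (a^v v) = Num.floor (a^v w).
  have ran x a : bd x -> a \in posroot Phi ->
      - N%:Z <= Num.floor (a^v x) <= N%:Z.
    move=> bx aP; have := bx a aP; rewrite ler_norml => /andP[lo hi].
    have KN : K < N%:R by apply: truncnS_gt.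
    apply/andP; split.
      by rewrite floor_ge_int intrN (le_trans _ lo) // lerN2 ltW.
    rewrite -(@ler_int R) (le_trans (floor_le _)) // (le_trans hi) //.
    exact: ltW.
  move=> bv bw e a aP.
  have ai : (index a (posroots Phi) < size (posroots Phi))%N.
    by rewrite index_mem mem_posroots.
  have ra : r (Ordinal ai) = a by rewrite /r nth_index // mem_posroots.
  move: e => /ffunP/(_ (Ordinal ai)); rewrite !ffunE ra => /(congr1 (@nat_of_ord _)).
  have /andP[v1 v2] := ran v a bv aP; have /andP[w1 w2] := ran w a bw aP.
  rewrite !inordK; lia.
pose Q t B := exists2 v, alcove_set B v & bd v /\ phi v = t.
pose c t := if pselect (exists B, Q t B) is left h then sval (cid h) else A0.
exists {ffun 'I_(size (posroots Phi)) -> 'I_(N.*2).+1}, c => A.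
have [v Av] := alcove_meet A; have [l ll lb] := KP v.
have [B Bv] : exists B, alcove_set B (v - l).
  apply: alcove_at; apply: compl_trans; first exact: root_latticeN.
  exact: alcove_compl Av.
have bv : bd (v - l) by move=> a aP; apply: lb; apply: pos_sub.
exists (phi (v - l)); rewrite /c; case: pselect => [h|[]]; last first.
  by exists B, (v - l).
case: cid => B' /= [w B'w [bw e]].
have -> : B' = B.
  apply: (alcove_common _ Bv); apply: (floor_alcove B'w).
    exact: alcove_compl Bv.
  exact: phiP.
by exists l => //; apply: (alcove_trans ll Bv); rewrite subrK.
Qed.

End FiniteOrbits.

(** * Graded modules *)

Section GradedModules.
Variable G : gring.
Implicit Types M N : gmod G.

Section MkGhom.
Variables (M N : gmod G) (f : M -> N).
Hypothesis f_lin : linear f.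
Hypothesis f_deg : forall d m, gdeg d m -> gdeg d (f m).

HB.instance Definition _ := GRing.isLinear.Build G M N *:%R f f_lin.

Definition mk_ghom : ghom M N := @GHom G M N f f_deg.
End MkGhom.

Lemma gdegD M d (x y : M) : gdeg d x -> gdeg d y -> gdeg d (x + y).
Proof.
have MP := gdegP M; move=> dx dy; rewrite -[y]opprK -[- y]sub0r.
by do 2!apply: (gradingB MP) => //; apply: grading0.
Qed.

Lemma grading_span_at M d (x : M) : exists (s : seq int) (c : int -> M),
  [/\ uniq s, d \in s, forall i, i \in s -> gdeg i (c i)
    & x = \sum_(i <- s) c i].
Proof.
have [s [c [us cs xE]]] := grading_span (gdegP M) x.
have [ds|ds] := boolP (d \in s); first by exists s, c.
exists (d :: s), (fun i => if i == d then 0 else c i); split.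
- by rewrite /= ds.
- exact: mem_head.
- move=> i; rewrite inE; case: eqP => [-> _|_ /= /cs//].
  exact: (grading0 (gdegP M)).
- rewrite big_cons eqxx add0r xE; apply: eq_big_seq => i si.
  by case: eqP => // e; rewrite -e si in ds.
Qed.

Lemma grading_eq M (s : seq int) (c e : int -> M) : uniq s ->
  (forall i, i \in s -> gdeg i (c i)) -> (forall i, i \in s -> gdeg i (e i)) ->
  \sum_(i <- s) c i = \sum_(i <- s) e i -> forall i, i \in s -> c i = e i.
Proof.
move=> us cs es ce i si; apply/eqP; rewrite -subr_eq0; apply/eqP.
apply: (grading_free (gdegP M) (c := fun i => c i - e i) us) si => [j sj|].
  by apply: (gradingB (gdegP M)); [apply: cs | apply: es].
by rewrite sumrB ce subrr.
Qed.

(** As f x is its own component of degree d, the component of x of degree d already maps to it. *)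
Lemma ghom_lift_deg M N (f : ghom M N) d (x : M) :
  gdeg d (f x) -> exists2 y, gdeg d y & f y = f x.
Proof.
move=> dfx; have [s [c [us ds cs xE]]] := grading_span_at d x.
exists (c d); first exact: cs.
have e : \sum_(i <- s) f (c i) = \sum_(i <- s) (if i == d then f x else 0).
  rewrite -linear_sum -xE (big_rem d) //= eqxx big_seq big1 ?addr0 // => i.
  by rewrite mem_rem_uniq // inE => /andP[/negPf->].
rewrite (grading_eq us _ _ e ds) ?eqxx // => i si; first exact/ghom_deg/cs.
by case: eqP => [->|_] //; apply: (grading0 (gdegP N)).
Qed.

Lemma ghom_inj_deg M N (f : ghom M N) d (x : M) :
  injective f -> gdeg d (f x) -> gdeg d x.
Proof. by move=> fI /ghom_lift_deg[y dy /fI <-]. Qed.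

(** * Kernels of graded homomorphisms *)

Section Kernel.
Variables (M N : gmod G) (f : ghom M N).

Definition gker_set : set M := [set m | f m = 0].
Fact gker_set0 : gker_set 0.
Proof. exact: linear0. Qed.
Fact gker_setL (a : G) x y : gker_set x -> gker_set y -> gker_set (a *: x + y).
Proof. by rewrite /gker_set /= linearP => -> ->; rewrite scaler0 addr0. Qed.
Definition gker_submod : submod M := SubMod gker_set0 gker_setL.

Lemma gker_mem m : f m = 0 -> m \in submod_mem gker_submod.
Proof. by move=> fm; apply/asboolP. Qed.

Lemma gkerP (w : subm gker_submod) : f (subm_val w) = 0.
Proof. by have /asboolP := subm_valP w. Qed.

Definition gker_deg (d : int) : set (subm gker_submod) :=
  [set w | gdeg d (subm_val w)].

Lemma gker_span m : f m = 0 -> exists (s : seq int) (c : int -> M),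
  [/\ uniq s, forall i, i \in s -> gdeg i (c i), m = \sum_(i <- s) c i
    & forall i, i \in s -> f (c i) = 0].
Proof.
move=> fm; have [s [c [us cs mE]]] := grading_span (gdegP M) m.
exists s, c; split=> //.
apply: (grading_free (gdegP N) us) => [i si|]; first exact/ghom_deg/cs.
by rewrite -linear_sum -mE.
Qed.

Fact gker_grading : is_grading gker_deg.
Proof.
have MP := gdegP M; split.
- by move=> d; rewrite /gker_deg /= ?linear0; apply: grading0.
- by move=> d x y dx dy; rewrite /gker_deg /= ?linearB; apply: (gradingB MP).
- by move=> d e a x ad ex; rewrite /gker_deg /= ?linearZ; apply: (gradingZ MP).
- move=> w; have [s [c [us cs wE c0]]] := gker_span (gkerP w).
  have h i : exists2 v : subm gker_submod, gker_deg i v & i \in s -> subm_val v = c i.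
    have [si|si] := boolP (i \in s).
      by exists (SubM (gker_mem (c0 i si))) => //; apply: cs.
    by exists 0 => //; rewrite /gker_deg /= ?linear0; apply: grading0.
  exists s, (fun i => s2val (cid2 (h i))); split=> //.
    by move=> i _; case: (cid2 _).
  apply: subm_val_inj; rewrite linear_sum wE; apply: eq_big_seq => i si.
  by case: (cid2 _) => v /= _ ->.
- move=> s c us cs c0 i si; apply: subm_val_inj; rewrite linear0.
  apply: (grading_free MP (c := fun i => subm_val (c i)) us cs _ si).
  by rewrite -(linear_sum (@subm_val _ _ gker_submod)) c0 linear0.
Qed.

Definition gker : gmod G := GMod gker_grading.
End Kernel.

End GradedModules.

(** * Modules over the structure algebra *)

Section Torsion.
Variables (R : realType) (V : vectType R) (Phi : posRootSystem V).
Variables (k : fieldType) (n : nat) (b : coweightBasis Phi n).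
Hypothesis char2 : 2%N \notin [pchar k].
Local Notation Z := (gstrz k b).
Implicit Types (A C : alcove Phi) (x : aorbit Phi).

(* Evaluating at the integers [zbasis b i a] sends the image of the coroot of a
   to [coroot a a = 2]. *)
Lemma crt_neq0 a : a \in roots Phi -> crt k b a != 0.
Proof.
move=> aR; apply: contra char2 => /eqP e0.
have h (i : 'I_n) : exists m : int, zbasis b i a = m%:~R.
  exact: (zbasis_in b i) a aR.
pose m i := sval (cid (h i)).
have mE i : zbasis b i a = (m i)%:~R by rewrite /m; case: cid.
have E : 2 = \sum_i m i * zcoord b (coroot Phi a) i.
  apply/eqP; rewrite -(@eqr_int R) -[2%:~R]/(2 : R) -(coroot2 aR).
  rewrite {1}(zbasis_span b (v := coroot Phi a)); last first.
    by move=> c cR; apply: coroot_int.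
  rewrite sum_lfunE raddf_sum /=; apply/eqP; apply: eq_bigr => i _.
  by rewrite -scaler_int scale_lfunE mE intrM; apply: mulrC.
have := congr1 (meval (fun i => (m i)%:~R : k)) e0.
rewrite /crt /coweight_im rmorph0 rmorph_sum /= => e.
rewrite inE /= -[2%:R]/(2%:~R : k) E rmorph_sum /= -[X in _ == X]e; apply/eqP.
apply: eq_bigr => i _.
by rewrite !rmorphM /= mevalXU rmorph_int mulrC.
Qed.

Lemma den0_neq0 (t : Z) : mset (den0 k b) t ->
  exists2 s : gsym k n, s != 0 & t = strz_diag b s.
Proof.
move=> [l /andP[/allP lP _] ->]; exists (\prod_(a <- l) crt k b a) => //.
rewrite prodf_seq_neq0; apply/allP => a /lP aP /=.
by apply/crt_neq0/pos_sub.
Qed.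

Lemma torsion_free_den (M : gmod Z) (t : Z) (m : M) : torsion_free M ->
  mset (den0 k b) t -> t *: m = 0 -> m = 0.
Proof. by move=> tf /den0_neq0[s s0 ->]; apply: tf. Qed.

Lemma frac_eq0 (M : gmod Z) (N : submod M) (m : subm N) t : torsion_free M ->
  frac (T := den0 k b) m t = 0 -> m = 0.
Proof.
move=> tf; rewrite -(frac0E _ t) => /fracE[u Tu]; rewrite !scaler0 => e.
apply: subm_val_inj; rewrite linear0.
apply: (torsion_free_den tf (denP t)); apply: (torsion_free_den tf Tu).
by have := congr1 (@subm_val _ _ N) e; rewrite linear0 2!linearZ.
Qed.

Lemma orb_mem A : orbit_car (orb A) A.
Proof.
exists 0; first by exists (fun=> 0); rewrite big1 // => a _; rewrite mulr0z.
apply/seteqP; split=> [v Av|_ [v Av <-]]; last by rewrite /atrans addr0.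
by exists v; rewrite // /atrans addr0.
Qed.

Lemma strz_orb (z : Z) A C : orbit_car (orb A) C -> z C = z A.
Proof.
move=> [l ll AC]; have /asboolP[_ zt] := strzP z.
by rewrite (zt A C l).
Qed.

Lemma char_funE x A : char_fun k b x A = if `[< orbit_car x A >] then crt_prod k b else 0.
Proof. by []. Qed.

(** On the orbit of A the function z is constant, and off it the characteristic function
    vanishes. *)
Lemma strz_char (z : Z) A :
  z * char_fun k b (orb A) = strz_diag b (z A) * char_fun k b (orb A).
Proof.
apply: val_inj; apply/funext => C.
rewrite -[LHS]/(z C * char_fun k b (orb A) C).
rewrite -[RHS]/(z A * char_fun k b (orb A) C) char_funE.
by case: asboolP => [/strz_orb ->|_]; rewrite ?mulr0.
Qed.

Lemma crt_prod_den0 : mset (den0 k b) (strz_diag b (crt_prod k b)).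
Proof. by have /asboolP := crt_prod_den k b. Qed.

(* There are finitely many orbits, and the sum of their characteristic
   functions is [crt_prod]; all summands but the one of A kill m. *)
Lemma strz_scale_at (M : gmod Z) (m : M) A : torsion_free M ->
  (forall x, x <> orb A -> char_fun k b x *: m = 0) ->
  forall z : Z, z *: m = strz_diag b (z A) *: m.
Proof.
move=> tf kill; have [T [c cP]] := finite_orbits A.
(* Induction over a list of orbits outside of which z vanishes. *)
suff vanish (ts : seq T) : forall z : Z, z A = 0 ->
    (forall C, (forall t, t \in ts -> ~ orbit_car (orb (c t)) C) -> z C = 0) ->
    z *: m = 0.
  move=> z; apply/eqP; rewrite -subr_eq0 -scalerBl; apply/eqP.
  apply: (vanish (enum T)); first exact: subrr.
  by move=> C h; have [t /h] := cP C; rewrite mem_enum => /(_ isT).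
elim: ts => [|t ts ih] z zA zC.
  rewrite (_ : z = 0) ?scale0r //; apply: val_inj; apply/funext => C.
  by apply: zC.
have [tA|tA] := pselect (orb (c t) = orb A).
  apply: ih => // C h; have [Ct|Ct] := pselect (orbit_car (orb (c t)) C).
    by rewrite tA in Ct; rewrite (strz_orb z Ct).
  by apply: zC => u; rewrite inE => /orP[/eqP->//|]; apply: h.
(* Multiplying z by [crt_prod] minus the characteristic function of the orbit of [c t] removes this
   orbit from the list. That function kills m, and [crt_prod] acts injectively. *)
apply: (torsion_free_den tf crt_prod_den0).
have h0 : char_fun k b (orb (c t)) *: (z *: m) = 0.
  by rewrite scalerA mulrC -scalerA kill // scaler0.
rewrite -[LHS]subr0 -[X in _ - X = _]h0 -scalerBl scalerA; apply: ih.
  rewrite -[LHS]/((crt_prod k b - char_fun k b (orb (c t)) A) * z A).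
  by rewrite zA mulr0.
move=> C h; rewrite -[LHS]/((crt_prod k b - char_fun k b (orb (c t)) C) * z C).
rewrite char_funE; case: asboolP => [_|Ct]; first by rewrite subrr mul0r.
rewrite zC ?mulr0 // => u; rewrite inE => /orP[/eqP->//|]; exact: h.
Qed.

End Torsion.

(** * Sheaves on the set of alcoves *)

Section Sheaves.
Variables (R : realType) (V : vectType R) (Phi : posRootSystem V).
Variables (k : fieldType) (n : nat) (b : coweightBasis Phi n).
Implicit Types (A C D : alcove Phi) (U W : aopen Phi) (F : sheaf k b).

Lemma aopen_eqP U W : aopen_set U = aopen_set W -> U = W.
Proof.
case: U W => U pU [W pW] /= e; move: pU pW; rewrite e => pU pW.
by rewrite (Prop_irrelevance pU pW).
Qed.

Lemma below_sub U A : aopen_set U A -> below A `<=` U.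
Proof. by move=> UA C CA; apply: aopenP CA. Qed.

Lemma restr_eq (F : presheaf k b) U W (h h' : W `<=` U) (m : F U) :
  restr F h m = restr F h' m.
Proof. by rewrite (Prop_irrelevance h h'). Qed.

(** {<= A} is the smallest open set containing A, so a sheaf is determined by its sections over
    these sets. *)
Definition below_cover U : set (aopen Phi) :=
  [set W | exists A, aopen_set U A /\ W = below A].

Lemma below_cover_sub U : aopenU (below_cover U) `<=` U.
Proof. by move=> C [_ [A [UA ->]] CA]; apply: aopenP CA. Qed.

Lemma sub_below_cover U : U `<=` aopenU (below_cover U).
Proof. by move=> A UA; exists (below A); [exists A | apply: ale_refl]. Qed.

Lemma sheaf_sep F U (m m' : F U) :
  (forall A (h : below A `<=` U), restr F h m = restr F h m') -> m = m'.
Proof.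
move=> e; apply/eqP; rewrite -subr_eq0; apply/eqP.
have [sep _] := sheafP F (below_cover U).
rewrite -[LHS](@res_id _ _ _ _ _ _ F U (fun _ => id)).
rewrite -(res_comp (@below_cover_sub U) (@sub_below_cover U)).
suff -> : restr F (@below_cover_sub U) (m - m') = 0 by rewrite linear0.
apply: sep => W CW; have [A [UA WE]] := CW; subst W.
by rewrite (res_comp _ _ (below_sub UA)) linearB e subrr.
Qed.

(** Compatibility along inclusions of {<= C} in {<= A} suffices, since the overlap of two members of
    the cover is again covered by such sets. *)
Lemma sheaf_glue F U d (s : forall A, aopen_set U A -> F (below A)) :
  (forall A UA, gdeg d (s A UA)) ->
  (forall A C UA UC (CA : below C `<=` below A),
     restr F CA (s A UA) = s C UC) ->
  exists2 m : F U, gdeg d m &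
    forall A UA (h : below A `<=` U), restr F h m = s A UA.
Proof.
move=> sd sc; have [_ glue] := sheafP F (below_cover U).
(* A member W of the cover equals some {<= A} only propositionally, so A is chosen and its section
   is carried to W by restriction. *)
pose pt W (CW : below_cover U W) := cid CW.
have ptU W CW : aopen_set U (sval (@pt W CW)).
  by rewrite /pt; case: (cid _) => A [].
have ptW W CW : W `<=` below (sval (@pt W CW)).
  by rewrite /pt; case: (cid _) => A [_ /= ->].
pose t W CW := restr F (@ptW W CW) (s _ (ptU W CW)).
have [m dm mE] : exists2 m : F (aopenU (below_cover U)), gdeg d m &
    forall W CW, restr F (aopenU_sup CW) m = t W CW.
  apply: glue => [W CW|W X CW CX]; first exact/ghom_deg/sd.
  apply: sheaf_sep => A h.
  have hW : below A `<=` W by move=> C /h[].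
  have hX : below A `<=` X by move=> C /h[].
  have UA : aopen_set U A.
    by apply: aopenP (ptU W CW) _; apply: (ptW); apply: hW; apply: ale_refl.
  rewrite /t !(res_comp _ _ hW) !(res_comp _ _ hX).
  rewrite (res_comp _ _ (fun C p => ptW W CW C (hW C p))).
  rewrite (res_comp _ _ (fun C p => ptW X CX C (hX C p))).
  by rewrite !(sc _ _ _ UA).
exists (restr F (@sub_below_cover U) m); first exact: ghom_deg.
move=> A UA h; have CA : below_cover U (below A) by exists A.
by rewrite (res_comp _ _ (aopenU_sup CA)) mE /t (sc _ _ _ UA).
Qed.

(** Antisymmetry of the order is what makes {< A} open. *)
Fact sbelow_subproof A C D : alt C A -> ale D C -> alt D A.
Proof.
move=> [CA nCA] DC; split; first exact: ale_trans DC CA.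
by move=> DA; apply: nCA; apply: ale_anti CA _; rewrite -DA.
Qed.
Definition sbelow A : aopen Phi := AOpen (@sbelow_subproof A).

Lemma sbelow_sub A : sbelow A `<=` below A.
Proof. by move=> C []. Qed.

Lemma hull_set1 A : aopen_hull [set A] = below A.
Proof.
apply: aopen_eqP; apply/seteqP; split=> [C [_ -> //]|C CA].
by exists A.
Qed.

Lemma locally_closed_set1 A : locally_closed [set A].
Proof.
exists (below A), (sbelow A); apply/seteqP; split=> [_ ->|C [CA nCA]].
  by split; [apply: ale_refl | case].
by apply: contrapT => nE; apply: nCA; split.
Qed.

Lemma bd_set1 A : aopen_bd [set A] = sbelow A.
Proof.
apply: aopen_eqP; rewrite locally_closed_bd; last exact: locally_closed_set1.
by rewrite hull_set1; apply/seteqP; split=> C [].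
Qed.

(* [F_[A]] in the notation of the paper. *)
Definition psect F A : gmod (gstrz k b) := gker (restr F (@sbelow_sub A)).

Lemma psect_res F A (m : F (below A)) :
  (forall C (h : alt C A), restr F (below_mono (proj1 h)) m = 0) <->
  restr F (@sbelow_sub A) m = 0.
Proof.
split=> [e|e C h].
  apply: sheaf_sep => C h; have hC : alt C A by apply: h; apply: ale_refl.
  by rewrite (res_comp _ _ (below_mono (proj1 hC))) e linear0.
have sub : below C `<=` sbelow A by apply: below_sub.
by rewrite -(res_comp (@sbelow_sub A) sub) e linear0.
Qed.

Hypothesis char2 : 2%N \notin [pchar k].

(** The support condition for {A} leaves in F_[A] only the component at the orbit of A, so the
    characteristic functions of the other orbits kill m. *)
Lemma psect_scale F A (m : F (below A)) :
  (forall U, torsion_free (F U)) -> support_condition F ->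
  restr F (@sbelow_sub A) m = 0 ->
  forall z : gstrz k b, z *: m = strz_diag b (z A) *: m.
Proof.
move=> tf supp m0; apply: strz_scale_at => // x xA.
(* [aopen_hull [set A]] and {<= A} are equal, but sections over them have different types;
   restriction both ways identifies them. *)
have hb : aopen_hull [set A] `<=` below A by rewrite hull_set1.
have bh : below A `<=` aopen_hull [set A] by rewrite hull_set1.
have bs : aopen_bd [set A] `<=` sbelow A by rewrite bd_set1.
have bb : aopen_bd [set A] `<=` below A by move=> C /bs /sbelow_sub.
have m'0 : restr F hb m \in submod_mem (lsect F [set A]).
  apply/asboolP; rewrite /= /lsect_set /= (res_comp _ _ bb).
  by rewrite -(res_comp (@sbelow_sub A) bs) m0 linear0.
pose w : subm (lsect F [set A]) := SubM m'0.
suff /(congr1 (@subm_val _ _ _)) : char_fun k b x *: w = 0.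
  rewrite linearZ linear0 /= => e.
  rewrite -[LHS](@res_id _ _ _ _ _ _ F _ (fun _ => id)) -(res_comp hb bh).
  by rewrite linearZ /= e linear0.
have p0 v : orb_proj x v = 0 :> loc (den0 k b) (subm (lsect F [set A])).
  apply/eqP; apply: contraT => nz; exfalso; apply: xA.
  have [|_ -> -> //] := supp _ (locally_closed_set1 A) x.
  by exists (orb_proj x v) => //; exists v.
apply: (frac_eq0 char2 (t := denM (crt_prod0 k b) (den1 _)) (tf _)).
by rewrite -locactE; apply: p0.
Qed.

End Sheaves.

(** * Exact sequences of sheaves *)

Section ExactSequences.
Variables (R : realType) (V : vectType R) (Phi : posRootSystem V).
Variables (k : fieldType) (n : nat) (b : coweightBasis Phi n).
Variables (L F F' : sheaf k b) (f : shhom L F) (g : shhom F F').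
Hypothesis fg : sh_exact f g.
Implicit Types (A C D : alcove Phi).

(** An open set containing A contains {<= A}, so local surjectivity at A is surjectivity over {<=
    A}. *)
Lemma exact_epi A (m : F' (below A)) : exists m', g (below A) m' = m.
Proof.
have [_ _ _ gs] := fg; have [W [h [WA [l lE]]]] := gs _ m A (ale_refl A).
exists (restr F (below_sub WA) l); rewrite shhom_res lE (res_comp _ _ (fun _ => id)).
exact: res_id.
Qed.

Lemma exact_ker A (m : F (below A)) : g _ m = 0 -> exists l, f (below A) l = m.
Proof.
have [_ _ ke _] := fg; move=> gm0.
have [W [h [WA [l lE]]]] := ke _ m gm0 A (ale_refl A).
exists (restr L (below_sub WA) l); rewrite shhom_res lE (res_comp _ _ (fun _ => id)).
exact: res_id.
Qed.

(** The restriction to {< A} of a homogeneous preimage of m comes from L, where homogeneity permits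
    gluing; as L is flabby, that section of L extends to {<= A}, and subtracting its image gives
    m'. *)
Lemma psect_epi_homog A d (m : F' (below A)) : flabby L -> gdeg d m ->
  restr F' (@sbelow_sub _ _ _ A) m = 0 ->
  exists m', g (below A) m' = m /\ restr F (@sbelow_sub _ _ _ A) m' = 0.
Proof.
move=> Lfl dm /psect_res m0; have [fI fg0 _ _] := fg.
have [m1 m1E] := exact_epi m.
have [m2 dm2 m2E] : exists2 m2, gdeg d m2 & g _ m2 = m.
  by rewrite -m1E; apply: ghom_lift_deg; rewrite m1E.
have lift C (h : alt C A) :
    exists l, f (below C) l = restr F (below_mono (proj1 h)) m2.
  by apply: exact_ker; rewrite shhom_res m2E m0.
pose s C h := sval (cid (lift C h)).
have sE C h : f (below C) (s C h) = restr F (below_mono (proj1 h)) m2.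
  by rewrite /s; case: cid.
have [l _ lE] : exists2 l : L (sbelow A), gdeg d l &
    forall C UC (h : below C `<=` sbelow A), restr L h l = s C UC.
  apply: sheaf_glue => [C h|C D hC hD DC].
    by apply: (ghom_inj_deg (fI _)); rewrite sE; apply: ghom_deg.
  by apply: (fI); rewrite shhom_res !sE (res_comp _ _ (below_mono (proj1 hD))).
have [l' l'E] := Lfl _ _ (@sbelow_sub _ _ _ A) l.
exists (m2 - f _ l'); split; first by rewrite linearB m2E fg0 subr0.
apply/psect_res => C h; rewrite linearB -shhom_res.
have sub : below C `<=` sbelow A by apply: below_sub.
by rewrite -(res_comp (@sbelow_sub _ _ _ A) sub) l'E lE sE subrr.
Qed.

Lemma psect_epi A (m : F' (below A)) : flabby L ->
  restr F' (@sbelow_sub _ _ _ A) m = 0 ->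
  exists m', g (below A) m' = m /\ restr F (@sbelow_sub _ _ _ A) m' = 0.
Proof.
move=> Lfl /gker_span[s [c [us cs -> c0]]].
rewrite big_seq; elim/big_ind: _ => [|x y [x' [<- x0]] [y' [<- y0]]|i si].
- by exists 0; rewrite !linear0.
- by exists (x' + y'); rewrite !linearD x0 y0 addr0.
- exact: psect_epi_homog (cs i si) (c0 i si).
Qed.

End ExactSequences.

(** * Lifting through a stalk *)

Section StalkFactorization.
Variables (R : realType) (V : vectType R) (Phi : posRootSystem V).
Variables (k : fieldType) (n : nat) (b : coweightBasis Phi n).
Hypothesis char2 : 2%N \notin [pchar k].
Variable A : alcove Phi.
Local Notation Z := (gstrz k b).
Local Notation x := (orb A).

Definition concentrated_at (M : gmod Z) : Prop :=
  forall (z : Z) (m : M), z *: m = strz_diag b (z A) *: m.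

Section StalkClass.
Variable E : gmod Z.

Definition stalk_class (e : E) : stalkz E x := SubM (stalk_mem x e).

Lemma stalk_classP (a : Z) (e e' : E) :
  stalk_class (a *: e + e') = a *: stalk_class e + stalk_class e'.
Proof.
apply: subm_val_inj; rewrite linearP /=.
by rewrite -addfrac -scalefrac linearP.
Qed.

Lemma stalk_class_scale (z : Z) (e : E) :
  stalk_class (z *: e) = strz_diag b (z A) *: stalk_class e.
Proof.
apply: subm_val_inj; rewrite linearZ /= /orb_proj !locactE.
rewrite [RHS]scalefrac !scalerA; congr (frac (_ *: _) _).
by rewrite mulrC strz_char.
Qed.

Lemma stalk_class_surj (p : stalkz E x) : exists e, stalk_class e = p.
Proof.
have /asboolP[_ [e _ <-] pE] := subm_valP p.
by exists e; apply: subm_val_inj.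
Qed.

Lemma stalk_class_deg d e : gdeg d e -> gdeg d (stalk_class e).
Proof. by move=> de; exists e. Qed.

Lemma stalk_class_eq0 (e : E) : torsion_free E -> stalk_class e = 0 ->
  char_fun k b x *: e = 0.
Proof.
move=> tf /(congr1 (@subm_val _ _ _)); rewrite linear0 /= /orb_proj locactE.
rewrite -(frac0E _ (den1 _)) => /fracE[u Tu]; rewrite !scaler0 => h.
apply: (torsion_free_den char2 tf (denP (den1 _))).
exact: (torsion_free_den char2 tf Tu).
Qed.

End StalkClass.

(* A map from E to a module concentrated at A factors through the stalk of E,
   where the lifting problem is one of graded S-modules. *)
Lemma stalk_projective_lift (E M N : gmod Z) (q : ghom M N) (delta : ghom E N) :
  torsion_free E -> torsion_free N ->
  concentrated_at M -> concentrated_at N ->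
  gprojective (stalk E x) -> (forall y, exists m, q m = y) ->
  exists kappa : ghom E M, forall e, q (kappa e) = delta e.
Proof.
move=> tE tN cM cN Pproj q_surj.
pose r := grscal (@strz_diag_deg _ _ _ k _ b).
(* The characteristic function of the orbit kills e - e', and it acts on N as [crt_prod], hence
   injectively. *)
have well e e' : stalk_class e = stalk_class e' -> delta e = delta e'.
  move=> ee; apply/eqP; rewrite -subr_eq0 -linearB; apply/eqP.
  have /(stalk_class_eq0 tE) h : stalk_class (e - e') = 0.
    by rewrite addrC -scaleN1r stalk_classP ee scaleN1r addNr.
  have := congr1 delta h; rewrite linearZ linear0 /= cN char_funE.
  case: asboolP => [_|[]]; last exact: orb_mem.
  exact: torsion_free_den (crt_prod_den0 k b).
pose rep (p : stalk E x) := sval (cid (stalk_class_surj p)).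
have repE p : stalk_class (rep p) = p by rewrite /rep; case: cid.
have d_lin : linear (fun p : stalk E x => delta (rep p) : r N).
  move=> s p p'; rewrite -[RHS]/(strz_diag b s *: delta (rep p) + delta (rep p')).
  rewrite -linearP; apply: well; rewrite stalk_classP !repE //.
have d_deg d (p : stalk E x) : gdeg d p -> gdeg d (delta (rep p) : r N).
  move=> [e de pE]; rewrite (well _ e) ?repE; first exact: ghom_deg.
  exact: subm_val_inj.
have q_lin : linear (q : r M -> r N).
  by move=> s m m'; exact: (linearP q (strz_diag b s) m m').
have q_deg d (m : r M) : gdeg d m -> gdeg d (q m : r N).
  exact: (@ghom_deg _ _ _ q d m).
have [h hE] := Pproj _ _ (mk_ghom q_lin q_deg) (mk_ghom d_lin d_deg) q_surj.
(* On the stalk and on M alike z acts as its coordinate at A, so S-linearity of h gives linearity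
   over the structure algebra. *)
have k_lin : linear (fun e => h (stalk_class e) : M).
  move=> z e e'; rewrite -[z *: e]addr0.
  have -> : stalk_class (z *: e + 0 + e') =
      (z A : gsym k n) *: (stalk_class e : stalk E x) + stalk_class e' :> stalk E x.
    rewrite addr0 -[z *: e]scale1r stalk_classP scale1r.
    by rewrite stalk_class_scale.
  by rewrite linearP cM.
have k_deg d e : gdeg d e -> gdeg d (h (stalk_class e) : M).
  by move=> de; apply: (ghom_deg h); apply: stalk_class_deg.
exists (mk_ghom k_lin k_deg) => e.
have := hE (stalk_class e); rewrite /= => ->.
by apply: well; rewrite repE.
Qed.

End StalkFactorization.

(** * Morphisms built alcove by alcove *)

Section Assembly.
Variables (R : realType) (V : vectType R) (Phi : posRootSystem V).
Variables (k : fieldType) (n : nat) (b : coweightBasis Phi n).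
Implicit Types (A C D : alcove Phi) (U W : aopen Phi) (F : sheaf k b).

(** The sheaf axiom glues homogeneous families only, so a general section is treated by components;
    uniqueness of the glued section gives linearity and compatibility with restriction. *)
Lemma shhom_glue (F F' : sheaf k b) (H : forall A, ghom (F (below A)) (F' (below A))) :
  (forall A C (CA : below C `<=` below A) m,
     restr F' CA (H A m) = H C (restr F CA m)) ->
  exists phi : shhom F F', forall U A (h : below A `<=` U) m,
    restr F' h (phi U m) = H A (restr F h m).
Proof.
move=> HC; pose spec U m s := forall A (h : below A `<=` U),
  restr F' h s = H A (restr F h m).
have spec_uniq U m s s' : spec U m s -> spec U m s' -> s = s'.
  by move=> sm s'm; apply: sheaf_sep => A h; rewrite sm s'm.
have exd U d (m : F U) : gdeg d m -> exists2 s, gdeg d s & spec U m s.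
  move=> dm.
  have [s ds sE] := @sheaf_glue _ _ _ _ _ _ F' U d
    (fun A UA => H A (restr F (below_sub UA) m))
    (fun A UA => ghom_deg _ (ghom_deg _ dm))
    (fun A C UA UC CA => etrans (HC A C CA _)
       (congr1 (H C) (res_comp (below_sub UA) CA (below_sub UC) m))).
  exists s => // A h; have UA : aopen_set U A by apply: h; apply: ale_refl.
  by rewrite (sE _ UA) (restr_eq _ h).
have ex U (m : F U) : exists s, spec U m s.
  have [r [c [_ cr ->]]] := grading_span (gdegP (F U)) m.
  rewrite big_seq; elim/big_ind: _ => [|x y [s sx] [t ty]|i ri].
  - by exists 0 => A h; rewrite !linear0.
  - by exists (s + t) => A h; rewrite !linearD sx ty.
  - by have [s _ ss] := exd U i _ (cr i ri); exists s.
pose phi U m := sval (cid (ex U m)).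
have phiP U m : spec U m (phi U m) by rewrite /phi; case: cid.
have phi_lin U : linear (phi U).
  move=> a m m'; apply: spec_uniq (phiP _ _) _ => A h.
  by rewrite !linearP !phiP.
have phi_deg U d m : gdeg d m -> gdeg d (phi U m).
  by move=> /exd[s ds /(spec_uniq _ _ _ _ (phiP U m)) ->].
have phi_res U W (h : W `<=` U) (m : F U) :
    mk_ghom (phi_lin W) (phi_deg W) (restr F h m) =
    restr F' h (mk_ghom (phi_lin U) (phi_deg U) m).
  apply: (spec_uniq W (restr F h m)) => [|A hA]; first exact: phiP.
  have hU : below A `<=` U by move=> C /hA /h.
  by rewrite !(res_comp _ _ hU) phiP.
by exists (ShHom phi_res) => U A h m; apply: phiP.
Qed.

Hypothesis char2 : 2%N \notin [pchar k].

(** * Correcting a lift by sections supported at one alcove *)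

Section Correction.
Variables (B L F F' : sheaf k b) (f : shhom L F) (g : shhom F F').
Variable h : shhom B F'.
Hypotheses (BC : inC B) (LC : inC L) (FC : inC F) (F'C : inC F').
Hypothesis fg : sh_exact f g.

Lemma inC_torsion_free F0 : inC F0 -> forall U, torsion_free (F0 U).
Proof. by case=> z _ _ _ _ U; case: (z U). Qed.

Lemma psect_torsion_free F0 A : inC F0 -> torsion_free (psect F0 A).
Proof.
move=> /inC_torsion_free tf s w s0 /(congr1 (@subm_val _ _ _)).
rewrite linearZ linear0 /= => e; apply: subm_val_inj; rewrite linear0.
exact: tf s0 e.
Qed.

Lemma psect_concentrated F0 A : inC F0 -> concentrated_at A (psect F0 A).
Proof.
move=> FC0 z w; apply: subm_val_inj; rewrite !linearZ /=.
apply: (psect_scale char2) (gkerP w) z; first exact: inC_torsion_free.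
by case: FC0.
Qed.

Lemma correct_lift A (hA : ghom (B (below A)) (F (below A))) :
  gprojective (stalk (B (below A)) (orb A)) ->
  (forall C (lt : alt C A) m, g _ (restr F (below_mono (proj1 lt)) (hA m)) =
     h _ (restr B (below_mono (proj1 lt)) m)) ->
  exists hA' : ghom (B (below A)) (F (below A)), forall m,
    g _ (hA' m) = h _ m /\
    forall C (lt : alt C A), restr F (below_mono (proj1 lt)) (hA' m) =
      restr F (below_mono (proj1 lt)) (hA m).
Proof.
move=> Bproj hAP.
have d0 m : restr F' (@sbelow_sub _ _ _ A) (h _ m - g _ (hA m)) = 0.
  by apply/psect_res => C lt; rewrite linearB -!shhom_res hAP subrr.
pose dl m : psect F' A := SubM (gker_mem (d0 m)).
have dl_lin : linear dl.
  move=> a m m'; apply: subm_val_inj; rewrite linearP /=.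
  by rewrite (linearP (h _)) (linearP hA) (linearP (g _)) scalerBr opprD addrACA.
have dl_deg d m : gdeg d m -> gdeg d (dl m).
  by move=> dm; apply: (gradingB (gdegP _)); do ?apply: ghom_deg.
have g0 (w : psect F A) : restr F' (@sbelow_sub _ _ _ A) (g _ (subm_val w)) = 0.
  by rewrite -shhom_res (gkerP w) linear0.
pose q w : psect F' A := SubM (gker_mem (g0 w)).
have q_lin : linear q.
  by move=> a m m'; apply: subm_val_inj; rewrite linearP /= !linearP.
have q_deg d w : gdeg d w -> gdeg d (q w) by move=> dw; apply: (ghom_deg (g _)).
have [|kap kapE] := stalk_projective_lift char2 (q := mk_ghom q_lin q_deg)
    (mk_ghom dl_lin dl_deg) (@inC_torsion_free _ BC _)
    (@psect_torsion_free _ A F'C)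
    (@psect_concentrated _ A FC) (@psect_concentrated _ A F'C) Bproj.
  move=> y; have Lfl : flabby L by case: LC.
  have [m [mE m0]] := psect_epi fg Lfl (gkerP y).
  by exists (SubM (gker_mem m0)); apply: subm_val_inj.
(* [kap] takes values in F_[A], so adding it changes no restriction to smaller alcoves. *)
have s_lin : linear (fun m => hA m + subm_val (kap m)).
  by move=> a m m'; rewrite (linearP hA) (linearP kap) linearP scalerDr addrACA.
have s_deg d m : gdeg d m -> gdeg d (hA m + subm_val (kap m)).
  by move=> dm; apply: gdegD; [apply: ghom_deg | apply: (ghom_deg kap)].
exists (mk_ghom s_lin s_deg) => m /=; split.
  have /(congr1 (@subm_val _ _ _)) /= e := kapE m.
  by rewrite linearD e addrC subrK.
move=> C lt; rewrite linearD.
by have /psect_res -> := gkerP (kap m); rewrite addr0.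
Qed.

End Correction.

Lemma alen_lower_bound (E : set (alcove Phi)) : finite_set E ->
  exists N : int, forall A, E A -> N <= alen A.
Proof.
move=> /(finite_image (@alen _ _ Phi)) /finite_seqP[s sE].
exists (- \sum_(i <- s) `|i|) => A EA.
have : alen A \in s by have : [set` s] (alen A) by rewrite -sE; exists A.
move=> As; rewrite lerNl (big_rem _ As) /= ler_wpDr ?sumr_ge0 //.
by rewrite -normrN ler_norm.
Qed.

(** The natural number max(alen - N + 1, 0) drops from A to C whenever C < A and [N <= alen C]. *)
Lemma alt_bounded_wf (N : int) :
  well_founded (fun C A : alcove Phi => alt C A /\ N <= alen C).
Proof.
suff acc m : forall A, (absz (Num.max (alen A - N + 1) 0)%R < m)%N ->
    Acc (fun C A : alcove Phi => alt C A /\ N <= alen C) A.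
  by move=> A; apply: (acc _ A (ltnSn _)).
elim: m => [|m ih] A; first by rewrite ltn0.
move=> Am; constructor=> C [/alt_alen CA NC]; apply: ih; move: CA NC Am.
by move: (alen A) (alen C) => i j; clear; lia.
Qed.

End Assembly.

(** * Recursion along the generic Bruhat order *)

Section Recursion.
Variables (R : realType) (V : vectType R) (Phi : posRootSystem V).
Variables (k : fieldType) (n : nat) (b : coweightBasis Phi n).
Variables (B F F' : sheaf k b) (g : shhom F F') (h : shhom B F').
Implicit Types A C D : alcove Phi.

Local Notation hom_at := (fun A => ghom (B (below A)) (F (below A))).

Fact zero_hom_lin A : linear (fun _ : B (below A) => 0 : F (below A)).
Proof. by move=> a m m'; rewrite scaler0 addr0. Qed.
Fact zero_hom_deg A d (m : B (below A)) :
  gdeg d m -> gdeg d (0 : F (below A)).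
Proof. by move=> _; apply: (grading0 (gdegP _)). Qed.
Definition zero_hom A : hom_at A := mk_ghom (@zero_hom_lin A) (@zero_hom_deg A).

Definition extends A (u : forall C, alt C A -> hom_at C) (hA : hom_at A) : Prop :=
  forall m, g _ (hA m) = h _ m /\
    forall C (lt : alt C A), restr F (below_mono (proj1 lt)) (hA m) =
      u C lt (restr B (below_mono (proj1 lt)) m).

(* The order on alcoves is not well-founded, but below the bound N the sections
   of B vanish. *)
Variable N : int.
Hypothesis B_bounded : forall A (m : B (below A)), ~ N <= alen A -> m = 0.
Hypothesis extend : forall A (u : forall C, hom_at C),
  (forall C, alt C A -> extends (fun D (_ : alt D C) => u D) (u C)) ->
  exists hA, extends (fun C (_ : alt C A) => u C) hA.

Let lower C A := alt C A /\ N <= alen C.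

(** The recursion supplies maps only where [N <= alen C]; elsewhere B has no nonzero sections over
    {<= C}, and 0 is the only map. *)
Definition below_family A (u : forall C, lower C A -> hom_at C)
    C (lt : alt C A) : hom_at C :=
  if pselect (N <= alen C) is left NC then u C (conj lt NC) else zero_hom C.

(** An extension is chosen if there is one; [rec_hom_extends] shows that there always is one for the
    family built here. *)
Definition rec_step A (u : forall C, lower C A -> hom_at C) : hom_at A :=
  if pselect (exists hA, extends (below_family u) hA) is left e then sval (cid e)
  else zero_hom A.

Definition rec_hom : forall A, hom_at A :=
  Fix (@alt_bounded_wf _ _ Phi N) hom_at rec_step.

Lemma rec_homE A : rec_hom A = rec_step (fun C (_ : lower C A) => rec_hom C).
Proof.
rewrite /rec_hom Fix_eq // => D u v uv.
suff -> : u = v by [].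
by apply: functional_extensionality_dep => C; apply: functional_extensionality_dep.
Qed.

Lemma rec_hom_extends A : extends (fun C (_ : alt C A) => rec_hom C) (rec_hom A).
Proof.
elim/(well_founded_ind (@alt_bounded_wf _ _ Phi N)): A => A ih.
(* The completed family and [rec_hom] can differ only where the source is 0. *)
have E hA : extends (below_family (fun C (_ : lower C A) => rec_hom C)) hA <->
    extends (fun C (_ : alt C A) => rec_hom C) hA.
  have e C (lt : alt C A) m :
      below_family (fun C (_ : lower C A) => rec_hom C) lt m = rec_hom C m.
    rewrite /below_family; case: pselect => // NC.
    by rewrite (B_bounded m NC) !linear0.
  by split=> x m; have [x1 x2] := x m; split=> // C lt; rewrite x2 e.
have [|hA hAE] := @extend A rec_hom.
  move=> C CA; have [NC|NC] := pselect (N <= alen C); first exact: ih.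
  move=> m; rewrite (B_bounded m NC) !linear0; split=> // D lt.
  by rewrite !linear0.
rewrite rec_homE /rec_step; case: pselect => [e|[]]; last by exists hA; apply/E.
by apply/E; case: cid.
Qed.

End Recursion.

Theorem proposition7p1 (R : realType) (V : vectType R) (Phi : posRootSystem V)
  (k : fieldType) (n : nat) (b : coweightBasis Phi n) (B : sheaf k b) :
  irreducible_roots Phi ->
  2%N \notin [pchar k] ->
  gkm_condition k b ->
  inC B ->
  (forall (x : aorbit Phi) (A : alcove Phi),
     orbit_car x A -> gprojective (stalk (B (below A)) x)) ->
  (forall (M : sheaf k b) (A : alcove Phi), inC M ->
     forall h : forall A', alt A' A -> ghom (B (below A')) (M (below A')),
     (forall A' A'' (lt' : alt A' A) (lt'' : alt A'' A) (lt : alt A'' A')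
        (m : B (below A')),
        restr M (below_mono (proj1 lt)) (h A' lt' m) =
        h A'' lt'' (restr B (below_mono (proj1 lt)) m)) ->
     exists hA : ghom (B (below A)) (M (below A)),
       forall A' (lt' : alt A' A) (m : B (below A)),
         restr M (below_mono (proj1 lt')) (hA m) =
         h A' lt' (restr B (below_mono (proj1 lt')) m)) ->
  projectiveC B.
Proof.
move=> _ char2 _ BC Bproj Bext; split=> // F F' g h FC F'C [L [f [LC fg]]].
have [N B_bounded] : exists N : int,
    forall A (m : B (below A)), ~ N <= alen A -> m = 0.
  have [_ _ [_ [E Efin EP]] _ _] := BC.
  (* A nonzero section over {<= A} puts A above an alcove of the finite set E, on which [alen] is at
     least N. *)
  have [N NE] := alen_lower_bound Efin; exists N => A m NA.
  apply/eqP; apply: contraT => m0; exfalso; apply: NA.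
  have [|C EC /ale_alen CA] := EP A; first by exists m.
  by apply: le_trans (NE C EC) _; case: CA => [->//|/ltW].
have ext A (u : forall C, ghom (B (below C)) (F (below C))) :
    (forall C, alt C A -> extends g h (fun D (_ : alt D C) => u D) (u C)) ->
    exists hA, extends g h (fun C (_ : alt C A) => u C) hA.
  (* Property (2) gives [hA0] with the prescribed restrictions; [correct_lift] turns it into a lift
     of h over {<= A}. *)
  move=> uP; have [|hA0 hA0E] := Bext F A FC (fun C _ => u C).
    by move=> C D CA DA DC m; have [_ ->] := uP C CA m.
  have [||hA hAE] := correct_lift char2 BC LC FC F'C fg (hA := hA0) (h := h).
  - exact/Bproj/orb_mem.
  - move=> C lt m; rewrite hA0E.
    by have [-> _] := uP C lt (restr B (below_mono (proj1 lt)) m).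
  exists hA => m; have [gm rm] := hAE m; split=> // C lt.
  by rewrite rm hA0E.
have uP := rec_hom_extends B_bounded ext; set u := rec_hom _ _ _ in uP.
have [|phi phiE] := @shhom_glue _ _ _ _ _ _ B F u.
  move=> A C CA m; have leCA : ale C A by apply: CA; apply: ale_refl.
  have [AC|AC] := pselect (C = A).
    by subst C; rewrite !res_id.
  have [_ /(_ C (conj leCA AC)) e] := uP A m.
  by rewrite (restr_eq _ (below_mono (proj1 (conj leCA AC)))) e (restr_eq _ CA).
exists phi => U m; apply: sheaf_sep => A hU.
rewrite -(shhom_res g) -(shhom_res h) phiE.
by have [-> _] := uP A (restr B hU m).
Qed.
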